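(* Let $(P_t)_{t\ge0}$ be the transition semigroup on $L^2(\mu)$ of a Markov process with invariant probability measure $\mu$ and generator $(\mathcal L,\mathrm{Dom}(\mathcal L))$. Let $L_0^2(\mu)=\mathbb H^l\oplus\mathbb H^h$ be an orthogonal decomposition into closed subspaces with orthogonal projection $\Pi$ onto $\mathbb H^l$, and let $\mathcal D_0$ be a core for the restriction of $\mathcal L$ to $\mathrm{Dom}(\mathcal L)\cap L_0^2(\mu)$ with $\Pi(\mathcal D_0)\subseteq\mathcal D_0$. Set $\mathcal D_0^l=\mathcal D_0\cap\mathbb H^l$ and $\mathcal D_0^h=\mathcal D_0\cap\mathbb H^h$. Suppose there are constants $\gamma,m_2,C_2\in(0,\infty)$ such that $$-\langle f,\mathcal Lf\rangle\ \ge\ \gamma\|f-\Pi f\|^2\quad\text{for all }f\in\mathcal D_0,$$ $$\|\mathcal Lf\|^2\ \ge\ m_2\|f\|^2\quad\text{for all }f\in\mathcal D_0^l,$$ $$\langle\mathcal Af,\mathcal Ag\rangle\ \le\ C_2\|f\|\,\|\mathcal C_2g\|\quad\text{for all }f\in\mathcal D_0^h,\ g\in\mathrm{Dom}(\mathcal C_2),$$ where $\mathcal A=\mathcal L-\gamma(\Pi-I)$ and $\mathcal C_2$ is the symmetric second-order collapse of $\mathcal L$. Then $$\|\overline P_tf\|\ \le\ \max\Bigl(\frac2{m_2},\frac{1+2C_2^2}{\gamma^2}\Bigr)^{1/2}\|\mathcal L\overline P_tf\|+\frac{4\gamma}{t}\max\Bigl(\frac2{m_2},\frac{1+2C_2^2}{\gamma^2}\Bigr)\|f-P_tf\|$$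 for all $f\in L_0^2(\mu)$ and $t>0$. In particular, $$\overline t_{\mathrm{rel}}(P)\ \le\ 16e\max\Bigl(\frac{2\gamma}{m_2},\frac{1+2C_2^2}{\gamma}\Bigr)\quad\text{and}\quad \mathrm s(\mathcal L)\ \ge\ \frac{1-e^{-1}}{8e}\min\Bigl(\frac{m_2}{2\gamma},\frac{\gamma}{1+2C_2^2}\Bigr).$$
   Context: $S$ is a Polish space with its Borel $\sigma$-algebra, $(p_t)_{t\ge0}$ is the transition function of a time-homogeneous Markov process on $S$ with invariant probability measure $\mu$, and $(P_tf)(x)=\int f(y)\,p_t(x,\mathrm dy)$. Then $(P_t)_{t\ge 0}$ is a strongly continuous contraction semigroup on $L^2(\mu)$ preserving $L^2_0(\mu)=\{f\in L^2(\mu):\int f\,\mathrm d\mu=0\}$; $\langle\cdot,\cdot\rangle,\|\cdot\|$ are the $L^2(\mu)$ inner product and norm. Time averages: $\overline P_tf=\frac1t\int_0^tP_sf\,\mathrm ds$. $\overline t_{\mathrm{rel}}(P)=\inf\{t\ge0:\|\overline P_s\|_{L_0^2(\mu)\to L_0^2(\mu)}\le1/e\text{ for all }s\ge t\}$. Singular value gap: $\mathrm s(\mathcal L)=\inf\{\|\mathcal Lf\|/\|f\|:f\in\mathrm{Dom}(\mathcal L)\cap L_0^2(\mu),f\ne0\}$. The operator $\mathcal A$ has domain $\mathrm{Dom}(\mathcal L)$ (restricted to $L_0^2(\mu)$). Symmetric second-order collapse: with the closed form $\mathcal E_2^{\mathcal L}(f,g)=\langle\mathcal Lf,\mathcal Lg\rangle$,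 $\mathrm{Dom}(\mathcal E_2^{\mathcal L})=\mathrm{Dom}(\mathcal L)$, $\mathcal C_2$ is the non-positive self-adjoint operator on $\mathbb H^l$ given by $\mathrm{Dom}(\mathcal C_2)=\{g\in\mathrm{Dom}(\mathcal L)\cap\mathbb H^l:\exists h\in\mathbb H^l\text{ with }\mathcal E_2^{\mathcal L}(f,g)=\langle f,h\rangle\ \forall f\in\mathrm{Dom}(\mathcal L)\cap\mathbb H^l\}$ and $-\mathcal C_2g=h$. (Since $\mathcal D_0$ is dense in $L_0^2(\mu)$, $\mathcal D_0^l\supseteq\Pi(\mathcal D_0)$ is dense in $\mathbb H^l$.)
   Formalization: Added assumption: D_0^l is a core for the restriction of L to Dom(L) ∩ H^l; Π(D_0) ⊆ D_0 alone does not ensure that the m_2-bound extends to Dom(L) ∩ H^l, and the statement fails without such an assumption. *)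

(* Defs.v *)
From HB Require Import structures.
From mathcomp Require Import all_boot all_order all_algebra.
From mathcomp Require Import all_classical all_reals all_analysis measurable_realfun.
Set Implicit Arguments.
Unset Strict Implicit.
Unset Printing Implicit Defensive.
Import Order.TTheory GRing.Theory Num.Theory.
Import numFieldNormedType.Exports.
Local Open Scope classical_set_scope.
Local Open Scope ring_scope.

(* LspaceType2 carries no algebraic structure in the library; an alias of it is
   equipped here with the normed-module structure inherited, through
   representatives, from LfunType. *)
Definition L2 d (T : measurableType d) (R : realType)
  (mu : {measure set T -> \bar R}) : Type := LspaceType2 mu.

Section L2_structure.
Context d (T : measurableType d) (R : realType).
Variable mu : {measure set T -> \bar R}.
Local Notation L := (L2 mu).
Local Notation F := (LfunType mu (lee1n 2)).

Definition L2val (f : L) : T -> R := aqEqMfun_to_fun (LebesgueSpace.sort f).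

Lemma L2valP (f : L) : L2val f \in Lfun mu 2%:E.
Proof.
rewrite inE; apply/andP; split.
  rewrite inE/= /L2val /aqEqMfun_to_fun; set g := repr _.
  exact: (@measurable_funPT _ _ _ _ g).
by rewrite inE; exact: (@Lebesgue_finite _ _ _ _ _ _ f).
Qed.

Definition L2rep (f : L) : F := Lfun_Sub (lee1n 2) (L2valP f).

Let ae_norm (f g : T -> R) : measurable_fun [set: T] f ->
  measurable_fun [set: T] g -> f = g %[ae mu] ->
  ('N[mu]_2%:E[EFin \o f] = 'N[mu]_2%:E[EFin \o g])%E.
Proof.
move=> mf mg fg; rewrite unlock /Lnorm; congr poweR.
have m (h : T -> R) : measurable_fun [set: T] h ->
    measurable_fun [set: T] (fun x => `|(EFin \o h) x| `^ 2)%E.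
  move=> mh; apply: (measurableT_comp (measurable_poweR _)).
  by apply: measurableT_comp => //; exact/measurable_EFinP.
apply: ge0_ae_eq_integral => //; try exact: m; last first.
- by apply: (filterS _ fg) => x /= + _ => /(_ I) ->.
- by move=> x _; exact: poweR_ge0.
- by move=> x _; exact: poweR_ge0.
Qed.

Let Lfun_measurable (g : F) : measurable_fun [set: T] (g : T -> R).
Proof. exact: measurable_funPT. Qed.

Let Lfun_measurableTypeR (g : F) :
  measurable_fun [set: T] (g : T -> measurableTypeR R).
Proof. exact: (Lfun_measurable g). Qed.

Definition mfun_class (g : F) : {mfun_ mu, T >-> measurableTypeR R} :=
  let mg := isMeasurableFun.Build _ _ T (measurableTypeR R) g
              (Lfun_measurableTypeR g) in
  let g' : {mfun T >-> measurableTypeR R} :=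
    HB.pack (g : T -> measurableTypeR R) mg in
  (\pi_({mfun_ mu, T >-> measurableTypeR R}) g')%qT.

Lemma mfun_classP (g : F) :
  (aqEqMfun_to_fun (mfun_class g) : T -> R) = g %[ae mu].
Proof.
rewrite /aqEqMfun_to_fun /mfun_class; case: piP => h /eqmodP/asboolP.
exact: ae_eq_sym.
Qed.

Lemma mfun_class_finite (g : F) :
  finite_norm mu 2%:E (aqEqMfun_to_fun (mfun_class g)).
Proof.
rewrite /finite_norm (ae_norm _ _ (mfun_classP g)).
- exact: Lfunction_finite.
- exact: (@measurable_funPT _ _ T (measurableTypeR R) (repr (mfun_class g))).
- exact: Lfun_measurable.
Qed.

Definition L2class (g : F) : L :=
  @LebesgueSpace.Pack _ _ _ _ _ (lee1n 2) _
    (LebesgueSpace.Class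
       (@isFinLebesgue.Axioms_ d T R mu 2%:E (lee1n 2) _ (mfun_class_finite g))).

Lemma L2classK (g : F) : L2val (L2class g) = g %[ae mu].
Proof. exact: mfun_classP. Qed.

Lemma L2_eqP (f g : L) : L2val f = L2val g %[ae mu] <-> f = g.
Proof.
split=> [|->]; last exact: ae_eq_refl.
case: f g => [f [[mf]]] [g [[mg]]]; rewrite /L2val/= => fg.
suff E : f = g by subst g; congr LebesgueSpace.Pack; congr LebesgueSpace.Class;
  congr isFinLebesgue.Axioms_; exact: Prop_irrelevance.
rewrite -[f]reprK -[g]reprK; apply/eqmodP/asboolP.
exact: fg.
Qed.

Lemma L2class_eq (f g : F) : (f : T -> R) = g %[ae mu] -> L2class f = L2class g.
Proof.
move=> fg; apply/L2_eqP; apply: (ae_eq_trans (L2classK f)).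
by apply: (ae_eq_trans fg); exact/ae_eq_sym/L2classK.
Qed.

Lemma L2repK (f : L) : L2class (L2rep f) = f.
Proof. exact/L2_eqP/L2classK. Qed.

Definition L2zero : L := L2class 0.
Definition L2opp (f : L) : L := L2class (- L2rep f).
Definition L2add (f g : L) : L := L2class (L2rep f + L2rep g).
Definition L2scale (a : R) (f : L) : L := L2class (a *: L2rep f).

Let addE f g : L2val (L2add f g) = (fun x => L2val f x + L2val g x) %[ae mu].
Proof. exact: L2classK. Qed.
Let oppE f : L2val (L2opp f) = (fun x => - L2val f x) %[ae mu].
Proof. exact: L2classK. Qed.
Let scaleE a f : L2val (L2scale a f) = (fun x => a * L2val f x) %[ae mu].
Proof. exact: L2classK. Qed.
Let zeroE : L2val L2zero = (fun x => 0) %[ae mu].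
Proof. exact: L2classK. Qed.

Let L2addA : associative L2add.
Proof.
move=> f g h; apply/L2_eqP; apply: filter_app (addE f (L2add g h)).
have := addE g h; have := addE (L2add f g) h; have := addE f g.
apply: filterS3 => x /= /(_ I) e1 /(_ I) e2 /(_ I) e3 /(_ I) e4 _.
by rewrite e4 e3 e2 e1 addrA.
Qed.

Let L2addC : commutative L2add.
Proof.
move=> f g; apply/L2_eqP; have := addE f g; have := addE g f.
apply: filterS2 => x /= /(_ I) e1 /(_ I) e2 _.
by rewrite e2 e1 addrC.
Qed.

Let L2add0 : left_id L2zero L2add.
Proof.
move=> f; apply/L2_eqP; have := addE L2zero f; have := zeroE.
apply: filterS2 => x /= /(_ I) e1 /(_ I) e2 _.
by rewrite e2 e1 add0r.
Qed.

Let L2addN : left_inverse L2zero L2opp L2add.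
Proof.
move=> f; apply/L2_eqP; have := addE (L2opp f) f; have := zeroE.
have := oppE f.
apply: filterS3 => x /= /(_ I) e1 /(_ I) e2 /(_ I) e3 _.
by rewrite e3 e1 e2 addNr.
Qed.

Let L2scaleA a b f : L2scale a (L2scale b f) = L2scale (a * b) f.
Proof.
apply/L2_eqP; have := scaleE a (L2scale b f); have := scaleE b f.
have := scaleE (a * b) f.
apply: filterS3 => x /= /(_ I) e1 /(_ I) e2 /(_ I) e3 _.
by rewrite e3 e1 e2 mulrA.
Qed.

Let L2scale1 : left_id 1 L2scale.
Proof.
move=> f; apply/L2_eqP; have := scaleE 1 f.
by apply: filterS => x /= /(_ I) e1 _; rewrite e1 mul1r.
Qed.

Let L2scaleDr : right_distributive L2scale L2add.
Proof.
move=> a f g; apply/L2_eqP; apply: filter_app (scaleE a (L2add f g)).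
apply: filter_app (addE f g).
have := addE (L2scale a f) (L2scale a g); have := scaleE a f.
have := scaleE a g; apply: filterS3 => x /=.
move=> /(_ I) e1 /(_ I) e2 /(_ I) e3 /(_ I) e4 /(_ I) e5 _.
by rewrite e5 e4 e3 e2 e1 mulrDr.
Qed.

Let L2scaleDl f a b : L2scale (a + b) f = L2add (L2scale a f) (L2scale b f).
Proof.
apply/L2_eqP; apply: filter_app (scaleE (a + b) f).
have := scaleE a f; have := scaleE b f.
have := addE (L2scale a f) (L2scale b f).
apply: filterS3 => x /= /(_ I) e1 /(_ I) e2 /(_ I) e3 /(_ I) e4 _.
by rewrite e4 e1 e2 e3 mulrDl.
Qed.

HB.instance Definition _ := gen_eqMixin L.
HB.instance Definition _ := gen_choiceMixin L.
HB.instance Definition _ :=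
  GRing.isZmodule.Build L L2addA L2addC L2add0 L2addN.
HB.instance Definition _ :=
  GRing.Zmodule_isLmodule.Build R L L2scaleA L2scale1 L2scaleDr L2scaleDl.

Lemma L2valD (f g : L) :
  L2val (f + g) = (fun x => L2val f x + L2val g x) %[ae mu].
Proof. exact: L2classK. Qed.
Lemma L2valN (f : L) : L2val (- f) = (fun x => - L2val f x) %[ae mu].
Proof. exact: L2classK. Qed.
Lemma L2valZ a (f : L) : L2val (a *: f) = (fun x => a * L2val f x) %[ae mu].
Proof. exact: L2classK. Qed.
Lemma L2val0 : L2val 0 = (fun x => 0) %[ae mu].
Proof. exact: L2classK. Qed.

Definition L2norm (f : L) : R := fine ('N[mu]_2%:E[EFin \o L2val f])%E.

Let normE (g : F) : L2norm (L2class g) = fine ('N[mu]_2%:E[EFin \o g])%E.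
Proof.
rewrite /L2norm; congr fine; apply: (@ae_norm (L2rep (L2class g)) g) => //.
exact: L2classK.
Qed.

Let ler_L2normD (f g : L) : L2norm (f + g) <= L2norm f + L2norm g.
Proof. by rewrite [X in X <= _]normE; exact: (ler_LnormD (L2rep f) (L2rep g)). Qed.

Let L2normZ a (f : L) : L2norm (a *: f) = `|a| * L2norm f.
Proof.
rewrite [LHS]normE (LnormZ (L2rep f) a) fineM//.
by rewrite -finite_norm_fine.
Qed.

Let L2norm_eq0 (f : L) : L2norm f = 0 -> f = 0.
Proof.
move=> /(@fine_Lnormr_eq0 _ _ _ mu _ _ (L2rep f)) f0; apply/L2_eqP.
by apply: (ae_eq_trans f0); exact/ae_eq_sym/L2val0.
Qed.

HB.instance Definition _ :=
  Lmodule_isNormed.Build R L ler_L2normD L2normZ L2norm_eq0.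

Lemma L2_normE (f : L) : `|f| = fine ('N[mu]_2%:E[EFin \o L2val f])%E.
Proof. by []. Qed.
End L2_structure.

Definition ip d (T : measurableType d) (R : realType)
    (mu : {measure set T -> \bar R}) (f g : L2 mu) : R :=
  \int[mu]_x (L2val f x * L2val g x).

(* The class of g, or 0 when g is not square-integrable. The latter never happens
   for the transition operators below: see kernel_integral_Lfun. *)
Definition L2of d (T : measurableType d) (R : realType)
    (mu : {measure set T -> \bar R}) (g : T -> R) : L2 mu :=
  if pselect (g \in Lfun mu 2%:E) is left h
  then L2class (Lfun_Sub (lee1n 2) h) else 0.

Section kernel_integral.
Context d (T : measurableType d) (R : realType) (mu : probability T R).

Definition kernel_integral (k : R.-pker T ~> T) (f : T -> R) : T -> R :=
  fun x => \int[k x]_y f y.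

Definition kernel_invariant (k : R.-pker T ~> T) :=
  forall A, measurable A -> (\int[mu]_x k x A = mu A)%E.

Definition const_kernel (_ : unit) : {measure set T -> \bar R} := mu.
Let const_kernel_measurable U : measurable U ->
  measurable_fun [set: unit] (const_kernel ^~ U).
Proof. by move=> mU; exact: measurable_cst. Qed.
HB.instance Definition _ :=
  isKernel.Build _ _ unit T R const_kernel const_kernel_measurable.
Let const_kernel_prob x : const_kernel x [set: T] = 1%E.
Proof. exact: probability_setT. Qed.
HB.instance Definition _ :=
  Kernel_isProbability.Build _ _ unit T R const_kernel const_kernel_prob.

Section snd_kernel.
Variable k : R.-pker T ~> T.
Definition snd_kernel (x : unit * T) : {measure set T -> \bar R} := k x.2.
Let snd_kernel_measurable U : measurable U ->
  measurable_fun [set: unit * T] (snd_kernel ^~ U).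
Proof.
move=> mU; exact: (measurableT_comp (measurable_kernel k U mU) measurable_snd).
Qed.
HB.instance Definition _ :=
  isKernel.Build _ _ (unit * T)%type T R snd_kernel snd_kernel_measurable.
Let snd_kernel_prob x : snd_kernel x [set: T] = 1%E.
Proof. exact: prob_kernel. Qed.
HB.instance Definition _ :=
  Kernel_isProbability.Build _ _ (unit * T)%type T R snd_kernel snd_kernel_prob.
End snd_kernel.

Lemma ge0_integral_kernel (k : R.-pker T ~> T) (f : T -> \bar R) :
  kernel_invariant k -> measurable_fun [set: T] f -> (forall x, 0 <= f x)%E ->
  (\int[mu]_x \int[k x]_y f y = \int[mu]_x f x)%E.
Proof.
move=> ki mf f0.
rewrite -(integral_kcomp const_kernel (snd_kernel k) tt f0 mf).
by apply: eq_measure_integral => A mA _; exact: ki.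
Qed.

Lemma kernel_integral_sqr_le (k : R.-pker T ~> T) (f : T -> R) x :
  measurable_fun [set: T] f ->
  (`|(kernel_integral k f x)%:E| `^ 2 <= \int[k x]_y (`|(f y)%:E| `^ 2))%E.
Proof.
move=> mf; have mEf : measurable_fun [set: T] (EFin \o f) by exact/measurable_EFinP.
rewrite -(@poweR_Lnorm _ _ _ (k x) (EFin \o f) 2)//.
apply: gt0_ler_poweR => //; rewrite ?in_itv/= ?leey ?andbT ?abse_ge0 ?Lnorm_ge0//.
have h2 : (2^-1 + 2^-1 : R) = 1 by rewrite [RHS]splitr !div1r.
have := hoelder (k x) mf (measurable_cst (1 : R)) (ltr0Sn R 1) (ltr0Sn R 1) h2.
rewrite (Lnorm_cst1 (k x) 2) prob_kernel poweR1r mule1 => h.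
apply: le_trans h; rewrite Lnorm1.
under eq_integral do rewrite /= mulr1.
apply: (le_trans _ (le_abse_integral _ _ mEf)) => //.
rewrite /kernel_integral /Rintegral.
by case: integral => [r| |] /=; rewrite ?normr0 ?leey ?lexx.
Qed.

Lemma kernel_integral_Lfun (k : R.-pker T ~> T) (f : T -> R) :
  kernel_invariant k -> f \in Lfun mu 2%:E ->
  kernel_integral k f \in Lfun mu 2%:E.
Proof.
move=> ki; rewrite !inE => /andP[]; rewrite !inE/= => mf ff.
have mEf : measurable_fun [set: T] (EFin \o f) by exact/measurable_EFinP.
have mk : measurable_fun [set: T] (kernel_integral k f).
  apply: (measurableT_comp (f := fine)) => //.
  rewrite [X in measurable_fun _ X](_ : _ = (fun x =>
    \int[k x]_y ((EFin \o f)^\+ y) - \int[k x]_y ((EFin \o f)^\- y))%E); last first.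
    by apply/funext => x; rewrite -integralE.
  apply: emeasurable_funB; apply: measurable_fun_integral_kernel => //.
  - by move=> U mU; exact: measurable_kernel.
  - exact: measurable_funepos.
  - by move=> U mU; exact: measurable_kernel.
  - exact: measurable_funeneg.
have msq (h : T -> R) : measurable_fun [set: T] h ->
    measurable_fun [set: T] (fun x => `|(EFin \o h) x| `^ 2)%E.
  move=> mh; apply: (measurableT_comp (measurable_poweR _)).
  by apply: measurableT_comp => //; exact/measurable_EFinP.
apply/andP; split; rewrite inE//=.
move: ff; rewrite /finite_norm unlock => /lty_poweRy ff.
apply: poweR_lty; apply: le_lt_trans (ff _); last by rewrite invr_eq0.
rewrite -[leRHS](@ge0_integral_kernel k)//; last 2 first.
- exact: msq.
- by move=> x; exact: poweR_ge0.
apply: ge0_le_integral => //.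
- by move=> x _; exact: poweR_ge0.
- exact: msq.
- apply: measurable_fun_integral_kernel => //.
  + by move=> U mU; exact: measurable_kernel.
  + by move=> x; exact: poweR_ge0.
  + exact: msq.
- by move=> x _; exact: kernel_integral_sqr_le.
Qed.

End kernel_integral.

Definition polish_space (R : realType) (S : topologicalType) :=
  (exists2 D : set S, countable D & dense D) /\
  exists dist : S -> S -> R,
    [/\ (forall x y, dist x y = 0 <-> x = y),
        (forall x y, dist x y = dist y x),
        (forall x y z, dist x z <= dist x y + dist y z),
        (forall x, nbhs x =
           filter_from [set e : R | 0 < e] (fun e => [set y | dist x y < e])) &
        (forall u : nat -> S,
           (forall e, 0 < e -> exists N, forall m n,
              (N <= m)%N -> (N <= n)%N -> dist (u m) (u n) < e) ->
           exists l : S, u @ \oo --> l)].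

Notation borel S := (g_sigma_algebraType (@open S)).

Section riemann_integral.
Context {R : realType} {V : normedModType R}.

(* Tagged partition a = x 0 <= xi 0 <= x 1 <= ... <= x n = b; the values of x and
   xi at larger indices are irrelevant. *)
Definition tagged_partition (a b : R) (n : nat) (x xi : nat -> R) :=
  [/\ x 0%N = a, x n = b & forall i, (i < n)%N -> x i <= xi i <= x i.+1].

Definition is_riemann_integral (F : R -> V) (a b : R) (I : V) :=
  forall e, 0 < e -> exists2 delta, 0 < delta &
    forall n x xi, tagged_partition a b n x xi ->
      (forall i, (i < n)%N -> x i.+1 - x i < delta) ->
      `|\sum_(i < n) (x i.+1 - x i) *: F (xi i) - I| < e.

Definition riemann_integral (F : R -> V) (a b : R) : V :=
  xget 0 (is_riemann_integral F a b).

Definition linear_subspace (H : set V) :=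
  H 0 /\ forall (a : R) u v, H u -> H v -> H (a *: u + v).

(* D is a core of the operator (L, Dom): a subspace of Dom that is dense in Dom
   for the graph norm. *)
Definition core (L : V -> V) (Dom D : set V) :=
  [/\ linear_subspace D, D `<=` Dom &
      forall f, Dom f -> forall e, 0 < e ->
        exists2 g, D g & `|f - g| < e /\ `|L f - L g| < e].

Definition opnorm (H : set V) (A : V -> V) : \bar R :=
  ereal_sup [set `|A f|%:E | f in [set f | H f /\ `|f| <= 1]].

End riemann_integral.

(* The transition semigroup on L^2(mu), its generator and its time averages.
   Only the kernels p t with t >= 0 matter. *)
Section markov_semigroup.
Context d (T : measurableType d) (R : realType) (mu : probability T R).
Variable p : R -> R.-pker T ~> T.

Definition transition_function :=
  (forall x A, measurable A -> p 0 x A = \d_x A) /\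
  (forall s t x A, 0 <= s -> 0 <= t -> measurable A ->
     p (s + t) x A = (\int[p s x]_y p t y A)%E).

Definition invariant_measure := forall t, 0 <= t -> kernel_invariant mu (p t).

Definition Psg (t : R) (f : L2 mu) : L2 mu :=
  L2of mu (kernel_integral (p t) (L2val f)).

Definition strongly_continuous :=
  forall f : L2 mu, Psg t f @[t --> 0^'+] --> f.

Definition L20 : set (L2 mu) := [set f | \int[mu]_x L2val f x = 0].

Definition gen_dom : set (L2 mu) :=
  [set f | cvg (t^-1 *: (Psg t f - f) @[t --> 0^'+])].

Definition gen (f : L2 mu) : L2 mu :=
  lim (t^-1 *: (Psg t f - f) @[t --> 0^'+]).

(* For t = 0 this is 0 (as 0^-1 = 0), which does not affect the infimum trel_avg:
   the condition at s = 0 only concerns the membership of the point t = 0. *)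
Definition time_avg (t : R) (f : L2 mu) : L2 mu :=
  t^-1 *: riemann_integral (Psg ^~ f) 0 t.

Definition trel_avg : \bar R :=
  ereal_inf [set t%:E | t in [set t | 0 <= t /\
    forall s, t <= s -> (opnorm L20 (time_avg s) <= (expR (-1))%:E)%E]].

(* Extended-real valued, so that the infimum over the empty set is +oo. *)
Definition sv_gap : \bar R :=
  ereal_inf [set (`|gen f| / `|f|)%:E | f in gen_dom `&` L20 `&` [set f | f != 0]].

Section decomposition.
Variable Hl : set (L2 mu).

(* Pi is only constrained on L^2_0, the only place where it is used. *)
Definition orthogonal_projection (Pi : L2 mu -> L2 mu) :=
  forall f, L20 f -> Hl (Pi f) /\ forall h, Hl h -> ip (f - Pi f) h = 0.

Definition E2 (f g : L2 mu) : R := ip (gen f) (gen g).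

(* collapse2_rel g h means - C_2 g = h; h is unique when gen_dom `&` Hl is dense
   in Hl. *)
Definition collapse2_rel (g h : L2 mu) :=
  [/\ gen_dom g, Hl g, Hl h &
      forall f, gen_dom f -> Hl f -> E2 f g = ip f h].

Definition collapse2_dom : set (L2 mu) := [set g | exists h, collapse2_rel g h].

Definition collapse2 (g : L2 mu) : L2 mu := - xget 0 (collapse2_rel g).

End decomposition.

Definition opA (gamma : R) (Pi : L2 mu -> L2 mu) (f : L2 mu) : L2 mu :=
  gen f - gamma *: (Pi f - f).

End markov_semigroup.

Arguments L20 {d T R} mu.

(* Main.v *)
Require Import Defs.
From HB Require Import structures.
From mathcomp Require Import all_boot all_order all_algebra.
From mathcomp Require Import all_classical all_reals all_analysis.
From mathcomp Require Import measurable_realfun ring lra.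
Import Order.TTheory GRing.Theory Num.Theory.
Import numFieldNormedType.Exports.
Local Open Scope classical_set_scope.
Local Open Scope ring_scope.
Set Implicit Arguments.
Unset Strict Implicit.
Unset Printing Implicit Defensive.

(** On H^l the operator A is L, on H^h it is L + gamma; this is why Lu = Lf - Lk can be written (Lf
    + gamma k) - Ak without leaving a term in k. Two points need care. Lax-Milgram wants coercivity
    and closedness on all of Dom(L) /\ H^l, not only on the core: the first comes from D0 /\ H^l
    being a core there, the second from closedness of L and of H^l. And [collapse2] picks some h, so
    g must determine h; this amounts to density of Dom(L) /\ H^l in H^l, which Pi(D0) <= D0
    provides. Closedness of L, density of its domain and the formula for L (time_avg t f) all rest
    on integrating s |-> P_s f in L^2(mu). The integral is built weakly, from scalar Lebesgue
    integrals and the Riesz theorem, and then recognised as a limit of Riemann sums by uniform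
    continuity. The last two claims use M >= 1 / gamma^2, hence sqrt M <= gamma M, so that |f| <= 3
    gamma M |Lf|. *)

(* Coercivity controls k = f - Pi f, so it remains to bound u = Pi f for f in the
   core. The form <Lf, Lg> on Dom(L) /\ H^l is closed and bounded below by m2, so
   Lax-Milgram yields g with - C_2 g = u. Then
     |u|^2 = <Lu, Lg> = <Lf + gamma k, Lg> - <Ak, Ag>,
   where |Lg| <= |u| / sqrt m2 and <Ak, Ag> is controlled by assumption. Expanding
   |Lf + gamma k|^2 and using gamma |k|^2 <= - <f, Lf> once more, the terms in k
   cancel up to - 2 gamma <Lf, u>, which leaves
     |f|^2 <= M (|Lf|^2 + 2 gamma |Lf| |f|),
   hence |f| <= (sqrt M + 2 gamma M) |Lf|, first on the core and then on
   Dom(L) /\ L^2_0. Applied to time averages, for which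
   L (time_avg t f) = (P_t f - f) / t, this gives the three claims. *)

(** * Hilbert spaces *)

Record inner_product {R : realType} {V : normedModType R} (dot : V -> V -> R)
    : Prop := InnerProduct {
  dotC : forall f g, dot f g = dot g f;
  dotDl : forall f g h, dot (f + g) h = dot f h + dot g h;
  dotZl : forall a f g, dot (a *: f) g = a * dot f g;
  dotff : forall f, dot f f = `|f| ^+ 2 }.

Definition cauchy_complete {R : realType} (V : normedModType R) :=
  forall u : nat -> V,
    (forall e, 0 < e -> exists N, forall m n,
       (N <= m)%N -> (N <= n)%N -> `|u m - u n| < e) ->
    exists l : V, u @ \oo --> l.

(** Operators are total functions, but an unbounded one such as a generator is linear only on its
    domain. *)
Definition linear_on {R : realType} {V W : lmodType R} (D : set V) (A : V -> W) :=
  forall a u v, D u -> D v -> A (a *: u + v) = a *: A u + A v.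

Section linear_on_theory.
Context {R : realType} {V : normedModType R} {W : lmodType R}.
Context {D : set V} {A : V -> W}.
Hypotheses (sD : linear_subspace D) (lA : linear_on D A).

Lemma subspaceD u v : D u -> D v -> D (u + v).
Proof. by move=> Du Dv; rewrite -[u]scale1r; apply: sD.2. Qed.

Lemma subspaceZ a u : D u -> D (a *: u).
Proof. by move=> Du; rewrite -[a *: u]addr0; apply: sD.2 => //; exact: sD.1. Qed.

Lemma subspaceB u v : D u -> D v -> D (u - v).
Proof. by move=> Du Dv; rewrite -scaleN1r addrC; exact: sD.2. Qed.

Lemma linear_onD u v : D u -> D v -> A (u + v) = A u + A v.
Proof. by move=> Du Dv; have := lA 1 Du Dv; rewrite !scale1r. Qed.

Lemma linear_on0 : A 0 = 0.
Proof. by apply: (@addrI _ (A 0)); rewrite -linear_onD ?addr0//; exact: sD.1. Qed.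

Lemma linear_onZ a u : D u -> A (a *: u) = a *: A u.
Proof.
by move=> Du; have := lA a Du (proj1 sD); rewrite linear_on0 !addr0.
Qed.

Lemma linear_onB u v : D u -> D v -> A (u - v) = A u - A v.
Proof.
by move=> Du Dv; have := lA (-1) Dv Du; rewrite !scaleN1r !(addrC (- _)).
Qed.

End linear_on_theory.

Lemma linear_subspaceT {R : realType} {V : normedModType R} :
  linear_subspace [set: V].
Proof. by []. Qed.

Section inner_product_theory.
Context {R : realType} {V : normedModType R} {dot : V -> V -> R}.
Hypothesis ipd : inner_product dot.

Lemma dotDr f g h : dot f (g + h) = dot f g + dot f h.
Proof. by rewrite (dotC ipd) (dotDl ipd) !(dotC ipd _ f). Qed.

Lemma dotZr a f g : dot f (a *: g) = a * dot f g.
Proof. by rewrite (dotC ipd) (dotZl ipd) (dotC ipd g). Qed.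

Lemma dotNl f g : dot (- f) g = - dot f g.
Proof. by rewrite -scaleN1r (dotZl ipd) mulN1r. Qed.

Lemma dotNr f g : dot f (- g) = - dot f g.
Proof. by rewrite -scaleN1r dotZr// mulN1r. Qed.

Lemma dotBl f g h : dot (f - g) h = dot f h - dot g h.
Proof. by rewrite (dotDl ipd) dotNl. Qed.

Lemma dotBr f g h : dot f (g - h) = dot f g - dot f h.
Proof. by rewrite dotDr// dotNr. Qed.

Lemma dot0l g : dot 0 g = 0.
Proof. by rewrite -(subrr g) dotBl subrr. Qed.

Lemma sqr_normD f g : `|f + g| ^+ 2 = `|f| ^+ 2 + 2 * dot f g + `|g| ^+ 2.
Proof. by rewrite -!(dotff ipd) (dotDl ipd) !dotDr (dotC ipd g f); ring. Qed.

Lemma cauchy_schwarz f g : `|dot f g| <= `|f| * `|g|.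
Proof.
have [->|g0] := eqVneq g 0.
  by rewrite (dotC ipd) dot0l normr0 normr0 mulr0.
have Ng0 : 0 < `|g| ^+ 2 by rewrite exprn_gt0// normr_gt0.
rewrite -ler_sqr ?nnegrE ?mulr_ge0//.
have := sqr_ge0 (`|f - (dot f g / `|g| ^+ 2) *: g|).
rewrite -(dotff ipd (f - _)) dotBl !dotBr !(dotZl ipd) !dotZr (dotC ipd g f)
  !(dotff ipd).
set a := dot f g => h.
rewrite exprMn real_normK ?num_real//.
have {h} : 0 <= (`|f| ^+ 2 - a / `|g| ^+ 2 * a - (a / `|g| ^+ 2 * a
   - a / `|g| ^+ 2 * (a / `|g| ^+ 2 * `|g| ^+ 2))) * `|g| ^+ 2.
  by rewrite mulr_ge0// ltW.
suff -> : (`|f| ^+ 2 - a / `|g| ^+ 2 * a - (a / `|g| ^+ 2 * a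
   - a / `|g| ^+ 2 * (a / `|g| ^+ 2 * `|g| ^+ 2))) * `|g| ^+ 2 =
   `|f| ^+ 2 * `|g| ^+ 2 - a ^+ 2 by rewrite subr_ge0.
by field; rewrite normr_eq0.
Qed.

Lemma norm_le_dot f C : 0 <= C -> (forall g, dot f g <= C * `|g|) -> `|f| <= C.
Proof.
move=> C0 h; have [->|f0] := eqVneq f 0; first by rewrite normr0.
have := h f; rewrite (dotff ipd) expr2 ler_pM2r// normr_gt0//.
Qed.

Lemma dot_eq0 f : (forall g, dot f g = 0) -> f = 0.
Proof.
by move=> /(_ f)/eqP; rewrite (dotff ipd) sqrf_eq0 normr_eq0 => /eqP.
Qed.

(* Lax-Milgram by minimising |T f|^2 - 2 l f over D: by the parallelogram law a
   minimising sequence u has T u, hence by coercivity u itself, Cauchy. *)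
Theorem lax_milgram (D : set V) (T : V -> V) (l : V -> R^o) (m C : R) :
  cauchy_complete V -> linear_subspace D -> linear_on D T -> linear_on D l ->
  (forall (u : nat -> V) f h, (forall n, D (u n)) ->
     u @ \oo --> f -> (T \o u) @ \oo --> h -> D f /\ T f = h) ->
  0 < m -> (forall f, D f -> m * `|f| ^+ 2 <= `|T f| ^+ 2) ->
  (forall f, D f -> `|l f| <= C * `|T f|) ->
  exists2 g, D g & forall f, D f -> dot (T f) (T g) = l f.
Proof.
move=> cV sD lT ll clT m0 coer lC.
pose J f : R := `|T f| ^+ 2 - 2 * l f.
pose E := J @` D.
have E0 : E !=set0 by exists (J 0), 0 => //; exact: sD.1.
have lbE : has_lbound E.
  (* Completing the square: J f >= |T f|^2 - 2 C |T f| >= - C^2. *)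
  exists (- C ^+ 2) => _ [f Df <-]; rewrite /J.
  have := lC f Df; have := ler_norm (l f); have := sqr_ge0 (`|T f| - C).
  rewrite sqrrB; lra.
have hE : has_inf E by split.
pose i := inf E.
have iJ f : D f -> i <= J f by move=> Df; apply: ge_inf => //; exists f.
have ex n : exists u, D u /\ J u < i + n.+1%:R^-1.
  have n0 : 0 < n.+1%:R^-1 :> R by rewrite invr_gt0.
  have [_ [u Du <-] h] := inf_adherent n0 hE.
  by exists u; split.
have [u uP] := choice ex.
have Du n : D (u n) by case: (uP n).
have uJ n : J (u n) < i + n.+1%:R^-1 by case: (uP n).
(* By the parallelogram law the right side minus the left is 4 (J c - i) with c the midpoint of a
   and b; the terms in l cancel. *)
have par a b : D a -> D b -> `|T a - T b| ^+ 2 <= 2 * (J a + J b - 2 * i).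
  move=> Da Db.
  have Dab : D (2^-1 *: (a + b)) by apply: subspaceZ => //; exact: subspaceD.
  have := iJ _ Dab; rewrite /J (linear_onZ sD lT) ?(linear_onZ sD ll);
    try exact: subspaceD.
  rewrite (linear_onD lT)// (linear_onD ll)//.
  rewrite normrZ exprMn ger0_norm// sqr_normD.
  rewrite (sqr_normD (T a) (- T b)) dotNr normrN.
  rewrite /GRing.scale/=.
  lra.
have TuC (e : R) : 0 < e -> exists N, forall p q, (N <= p)%N -> (N <= q)%N ->
    `|T (u p) - T (u q)| < e.
  move=> e0.
  (* Beyond N both values of J exceed i by less than 1 / (N + 1), so [par] bounds the squared
     distance by 2 (2 / (N + 1)). *)
  have [N hN] : exists N : nat, 4 * N.+1%:R^-1 < e ^+ 2.
    have e2 : 0 < e ^+ 2 / 4 by rewrite divr_gt0// exprn_gt0.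
    have [N hN] := @ltr_add_invr R 0 (e ^+ 2 / 4) e2.
    by exists N; move: hN; rewrite add0r ltr_pdivlMr// mulrC.
  exists N => p q Np Nq.
  have inv k : (N <= k)%N -> k.+1%:R^-1 <= N.+1%:R^-1 :> R.
    by move=> Nk; rewrite lef_pV2 ?posrE// ler_nat.
  rewrite -ltr_sqr ?nnegrE ?(ltW e0)//.
  have := par _ _ (Du p) (Du q); have := uJ p; have := uJ q.
  have := inv _ Np; have := inv _ Nq; move: hN.
  set a := p.+1%:R^-1; set b := q.+1%:R^-1; set c := N.+1%:R^-1.
  move: (J _) (J _) a b c (`|_| ^+ 2) (e ^+ 2) => Jp Jq a b c x y; lra.
have [h Th] := cV (T \o u) TuC.
have uC (e : R) : 0 < e -> exists N, forall p q, (N <= p)%N -> (N <= q)%N ->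
    `|u p - u q| < e.
  move=> e0.
  have sm0 : 0 < Num.sqrt m by rewrite sqrtr_gt0.
  have [N hN] := TuC (Num.sqrt m * e) (mulr_gt0 sm0 e0).
  exists N => p q Np Nq.
  have := hN p q Np Nq; rewrite -(linear_onB lT)//.
  have := coer _ (subspaceB sD (Du p) (Du q)).
  rewrite -[X in X * _](sqr_sqrtr (ltW m0)) -exprMn => h1 h2.
  rewrite -(ltr_pM2l sm0); apply: le_lt_trans h2.
  by rewrite -ler_sqr ?nnegrE ?mulr_ge0// ltW.
have [g ug] := cV u uC.
have [Dg Tg] := clT _ _ _ Du ug Th.
exists g => // f Df; rewrite Tg.
pose a := dot (T f) h - l f; pose B := `|T f| ^+ 2.
(* First variation: the right side is J (s f + g) - J g. Its sign for all s forces a = 0; the choice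
   s = - a / (B + 1) avoids dividing by B, which may vanish. *)
suff sB s : 0 <= s ^+ 2 * B + 2 * s * a.
  have B0 : 0 <= B by exact: sqr_ge0.
  have := sB (- a / (B + 1)).
  have -> : (- a / (B + 1)) ^+ 2 * B + 2 * (- a / (B + 1)) * a =
     - (a ^+ 2 * (B + 2) / (B + 1) ^+ 2) by field; rewrite gt_eqF//; lra.
  rewrite oppr_ge0 pmulr_lle0 ?invr_gt0 ?exprn_gt0//; last by lra.
  rewrite pmulr_lle0; last by lra.
  by rewrite exprn_even_le0//= subr_eq0 => /eqP.
(* The variation is taken at u N instead of g: J (u N) exceeds i by at most e / 2, and replacing T
   (u N) by its limit h in the cross term costs another e / 2. *)
apply/ler_addgt0Pl => e e0.
pose c := 2 * `|s| * `|T f|.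
have c0 : 0 <= c by rewrite !mulr_ge0.
have e1 : 0 < e / (2 * (c + 1)) by rewrite divr_gt0//; lra.
have [N [hN1 hN2]] : exists N, `|h - T (u N)| < e / (2 * (c + 1)) /\
    N.+1%:R^-1 < e / 2.
  have [N0 hN0] : exists N : nat, N.+1%:R^-1 < e / 2.
    have e2 : 0 < e / 2 by rewrite divr_gt0.
    have [N hN] := @ltr_add_invr R 0 (e / 2) e2.
    by exists N; rewrite add0r in hN.
  have /cvgrPdist_lt/(_ _ e1)[N1 _ hN1] := Th.
  exists (maxn N0 N1); split; first by apply: hN1 => /=; exact: leq_maxr.
  apply: le_lt_trans hN0.
  by rewrite lef_pV2 ?posrE// ler_nat ltnS leq_maxl.
have := iJ _ (sD.2 s f (u N) Df (Du N)); have := uJ N; rewrite /J.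
rewrite lT// ll// sqr_normD (dotZl ipd) normrZ exprMn real_normK ?num_real//.
rewrite -/B /GRing.scale/=.
have : 2 * s * dot (T f) (T (u N)) <= 2 * s * dot (T f) h + e / 2.
  rewrite -lerBlDl -mulrBr -dotBr.
  apply: le_trans (ler_norm _) _; rewrite 2!normrM (ger0_norm (ler0n _ 2)).
  apply: (@le_trans _ _ (c * `|h - T (u N)|)).
    rewrite /c -[X in _ <= X]mulrA ler_wpM2l// ?mulr_ge0// distrC.
    exact: cauchy_schwarz.
  apply: (@le_trans _ _ (c * (e / (2 * (c + 1))))).
    by rewrite ler_wpM2l// ltW.
  have -> : c * (e / (2 * (c + 1))) = e / 2 * (c / (c + 1)) by field; lra.
  by rewrite ler_piMr//; [rewrite ltW// divr_gt0|rewrite ler_pdivrMr; lra].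
rewrite /a; move: hN2; move: (_^-1) => x; lra.
Qed.

Corollary riesz (l : V -> R^o) (C : R) : cauchy_complete V ->
  linear_on [set: V] l -> (forall f, `|l f| <= C * `|f|) ->
  exists g, forall f, dot f g = l f.
Proof.
move=> cV ll lC.
suff [g _ gl] : exists2 g, [set: V] g & forall f, [set: V] f -> dot f g = l f.
  by exists g => f; exact: gl.
apply: (@lax_milgram [set: V] id l 1 C) => //.
- by move=> u f h _ uf uh; split=> //; exact: (cvg_unique _ uf uh).
- by move=> f _; rewrite mul1r.
Qed.

End inner_product_theory.

(** * Riemann integrals of Hilbert-space-valued functions *)

Section riemann_integral_theory.
Context {R : realType} {V : normedModType R}.
Implicit Types (F : R -> V) (a b : R) (x xi : nat -> R).

Lemma tagged_partition_mono a b n x xi : tagged_partition a b n x xi ->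
  forall i j, (i <= j)%N -> (j <= n)%N -> x i <= x j.
Proof.
move=> [_ _ xP] i; elim=> [|j IH]; first by rewrite leqn0 => /eqP ->.
rewrite leq_eqVlt => /predU1P[->//|]; rewrite ltnS => ij jn.
have /andP[h1 h2] := xP j jn.
by rewrite (le_trans (IH ij (ltnW jn)))// (le_trans h1).
Qed.

Lemma tagged_partition_tag a b n x xi : tagged_partition a b n x xi ->
  forall i, (i < n)%N -> a <= xi i <= b.
Proof.
move=> tp i iltn; have mono := tagged_partition_mono tp.
have [<- <- /(_ i iltn)/andP[h1 h2]] := tp.
rewrite (le_trans _ h1)/=; last by apply: mono => //; exact: ltnW.
by rewrite (le_trans h2)//; exact: mono.
Qed.

Lemma tagged_partition_exists a b d : a <= b -> 0 < d ->
  exists n x xi, tagged_partition a b n x xi /\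
    forall i, (i < n)%N -> x i.+1 - x i < d.
Proof.
move=> ab d0.
have [n hn] : exists n : nat, (b - a) / n.+1%:R < d.
  have e0 : 0 < d / (b - a + 1) by rewrite divr_gt0//; lra.
  have [n] := @ltr_add_invr R 0 _ e0; rewrite add0r => hn; exists n.
  move: hn; rewrite ltr_pdivlMr; last by lra.
  have : 0 < n.+1%:R^-1 :> R by rewrite invr_gt0.
  move: (_^-1) => c; lra.
pose x i : R := a + i%:R * ((b - a) / n.+1%:R).
have xS i : x i.+1 - x i = (b - a) / n.+1%:R by rewrite /x -natr1; ring.
exists n.+1, x, x; split; last by move=> i _; rewrite xS.
split.
- by rewrite /x mul0r addr0.
- by rewrite /x mulrC divfK ?pnatr_eq0//; ring.
- by move=> i _; rewrite lexx/= -subr_ge0 xS divr_ge0// subr_ge0.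
Qed.

(** Two integrals are compared on one partition fine enough for both. When a > b there is no tagged
    partition, so every vector is an integral; hence [a <= b]. *)
Lemma is_riemann_integral_unique F a b I J : a <= b ->
  is_riemann_integral F a b I -> is_riemann_integral F a b J -> I = J.
Proof.
move=> ab FI FJ; apply/eqP; rewrite -subr_eq0 -normr_eq0; apply/eqP.
apply/eqP; rewrite eq_le normr_ge0 andbT; apply/ler_addgt0Pl => e e0.
rewrite addr0.
have e2 : 0 < e / 2 by rewrite divr_gt0.
have [d1 d10 h1] := FI _ e2; have [d2 d20 h2] := FJ _ e2.
have d0 : 0 < Num.min d1 d2 by rewrite lt_min d10.
have [n [x [xi [tp mesh]]]] := tagged_partition_exists ab d0.
have {}h1 : `|\sum_(i < n) (x i.+1 - x i) *: F (xi i) - I| < e / 2.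
  by apply: h1 => // i /mesh; rewrite lt_min => /andP[].
have {}h2 : `|\sum_(i < n) (x i.+1 - x i) *: F (xi i) - J| < e / 2.
  by apply: h2 => // i /mesh; rewrite lt_min => /andP[].
have -> : I - J = (\sum_(i < n) (x i.+1 - x i) *: F (xi i) - J) -
    (\sum_(i < n) (x i.+1 - x i) *: F (xi i) - I).
  by rewrite opprB [RHS]addrC addrA subrK.
apply: le_trans (ler_normB _ _) _; lra.
Qed.

Lemma riemann_integralE F a b I : a <= b ->
  is_riemann_integral F a b I -> riemann_integral F a b = I.
Proof.
move=> ab FI; apply: (is_riemann_integral_unique ab _ FI).
exact: xgetPex (ex_intro _ I FI).
Qed.

Lemma eq_is_riemann_integral F G a b I : (forall s, a <= s <= b -> F s = G s) ->
  is_riemann_integral F a b I -> is_riemann_integral G a b I.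
Proof.
move=> FG FI e /FI[d d0 h]; exists d => // n x xi tp mesh.
rewrite (eq_bigr (fun i : 'I_n => (x i.+1 - x i) *: F (xi i))); first exact: h.
by move=> i _; rewrite FG//; exact: tagged_partition_tag tp _ _.
Qed.

Lemma is_riemann_integral_shift F a b h I :
  is_riemann_integral (fun s => F (s + h)) a b I ->
  is_riemann_integral F (a + h) (b + h) I.
Proof.
move=> FI e /FI[d d0 H]; exists d => // n x xi [xa xb xP] mesh.
have := H n (fun i => x i - h) (fun i => xi i - h).
rewrite (eq_bigr (fun i : 'I_n => (x i.+1 - x i) *: F (xi i))); last first.
  by move=> i _; rewrite subrK; congr (_ *: _); ring.
apply.
- by split=> [||i /xP]; rewrite ?xa ?xb ?addrK// !lerD2r.
- by move=> i /mesh; congr (_ < _); ring.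
Qed.

Lemma is_riemann_integral_map (A : V -> V) F a b I :
  linear_on [set: V] A -> (forall f, `|A f| <= `|f|) ->
  is_riemann_integral F a b I ->
  is_riemann_integral (A \o F) a b (A I).
Proof.
move=> lA cA FI e /FI[d d0 h]; exists d => // n x xi tp mesh.
have sT := @linear_subspaceT R V.
have -> : \sum_(i < n) (x i.+1 - x i) *: (A \o F) (xi i) =
    A (\sum_(i < n) (x i.+1 - x i) *: F (xi i)).
  rewrite (@big_morph _ _ A 0 +%R 0 +%R); last 2 first.
  - by move=> u v; rewrite (linear_onD lA).
  - exact: linear_on0 sT lA.
  by apply: eq_bigr => i _; rewrite (linear_onZ sT lA).
by rewrite -(linear_onB lA)//; apply: le_lt_trans (cA _) _; exact: h.
Qed.

Lemma is_riemann_integral_lin F G a b c I J :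
  is_riemann_integral F a b I -> is_riemann_integral G a b J ->
  is_riemann_integral (fun s => c *: F s + G s) a b (c *: I + J).
Proof.
move=> FI GJ e e0.
have c0 : 0 < `|c| + 1 by rewrite ltr_wpDl.
have e1 : 0 < e / (2 * (`|c| + 1)) by rewrite divr_gt0// mulr_gt0.
have e2 : 0 < e / 2 by rewrite divr_gt0.
have [d1 d10 h1] := FI _ e1; have [d2 d20 h2] := GJ _ e2.
exists (Num.min d1 d2); first by rewrite lt_min d10.
move=> n x xi tp mesh.
have {}h1 : `|\sum_(i < n) (x i.+1 - x i) *: F (xi i) - I| < e / (2 * (`|c| + 1)).
  by apply: h1 => // i /mesh; rewrite lt_min => /andP[].
have {}h2 : `|\sum_(i < n) (x i.+1 - x i) *: G (xi i) - J| < e / 2.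
  by apply: h2 => // i /mesh; rewrite lt_min => /andP[].
have -> : \sum_(i < n) (x i.+1 - x i) *: (c *: F (xi i) + G (xi i)) -
    (c *: I + J) = c *: (\sum_(i < n) (x i.+1 - x i) *: F (xi i) - I) +
    (\sum_(i < n) (x i.+1 - x i) *: G (xi i) - J).
  rewrite scalerBr scaler_sumr opprD addrACA -big_split/=; congr (_ + _).
  by apply: eq_bigr => i _; rewrite scalerDr !scalerA (mulrC c).
apply: le_lt_trans (ler_normD _ _) _; rewrite normrZ.
have : `|c| * `|\sum_(i < n) (x i.+1 - x i) *: F (xi i) - I| <= e / 2.
  apply: (@le_trans _ _ (`|c| * (e / (2 * (`|c| + 1))))).
    by rewrite ler_wpM2l// ltW.
  have -> : `|c| * (e / (2 * (`|c| + 1))) = e / 2 * (`|c| / (`|c| + 1)).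
    by field; lra.
  by rewrite ler_piMr ?(ltW e2)// ler_pdivrMr// mul1r lerDl.
lra.
Qed.

(* A primitive of F, presented as an interval function. *)
Lemma is_riemann_integral_primitive F (G : R -> R -> V) a b :
  (forall e, 0 < e -> exists2 d, 0 < d & forall s t, `|s - t| < d ->
     `|F s - F t| < e) ->
  (forall r s t, r <= s -> s <= t -> G r t = G r s + G s t) ->
  (forall s t v e, s <= t -> (forall r, s <= r <= t -> `|F r - v| <= e) ->
     `|G s t - (t - s) *: v| <= (t - s) * e) ->
  a <= b -> is_riemann_integral F a b (G a b).
Proof.
move=> uF Gadd Gest ab e e0.
(* On each cell the error is at most the length of the cell times this quantity; the total (b - a) e
   / (b - a + 1) is below e, also when a = b. *)
have e1 : 0 < e / (b - a + 1) by rewrite divr_gt0//; lra.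
have [d d0 dF] := uF _ e1; exists d => // n x xi tp mesh.
have mono := tagged_partition_mono tp.
have [xa xb xP] := tp.
have tele k : (k <= n)%N -> G (x 0%N) (x k) = \sum_(i < k) G (x i) (x i.+1).
  elim: k => [_|k IH kn].
    (* Additivity over a degenerate interval gives G r r = 0. *)
    rewrite big_ord0; have := Gadd _ _ _ (lexx (x 0%N)) (lexx (x 0%N)).
    by move/eqP; rewrite -subr_eq subrr eq_sym => /eqP.
  rewrite big_ord_recr/= -IH ?(ltnW kn)//; apply: Gadd.
  - by apply: mono => //; exact: ltnW.
  - exact: mono.
rewrite -{1}xa -xb tele// -sumrB.
apply: (@le_lt_trans _ _ (\sum_(i < n) (x i.+1 - x i) * (e / (b - a + 1)))).
  apply: le_trans (ler_norm_sum _ _ _) _; apply: ler_sum => i _.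
  rewrite distrC; apply: Gest; first exact: mono.
  move=> r /andP[r1 r2]; apply/ltW/dF.
  have /andP[h1 h2] := xP i (ltn_ord i).
  have := mesh i (ltn_ord i); rewrite ltr_norml => ?; apply/andP; split; lra.
rewrite -mulr_suml.
have -> : \sum_(i < n) (x i.+1 - x i) = b - a.
  by rewrite -(big_mkord xpredT (fun i => x i.+1 - x i)) telescope_sumr// xa xb.
rewrite mulrA ltr_pdivrMr; nra.
Qed.

End riemann_integral_theory.

Section weak_integral.
Context {R : realType} {V : normedModType R} {dot : V -> V -> R}.
Hypotheses (ipd : inner_product dot) (cV : cauchy_complete V).
Variables (F : R -> V) (B : R).
Hypothesis uF : forall e, 0 < e -> exists2 d, 0 < d & forall s t, `|s - t| < d ->
  `|F s - F t| < e.
Hypothesis bF : forall s, `|F s| <= B.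
Local Notation leb := (@lebesgue_measure R).

Let B0 : 0 <= B. Proof. exact: le_trans (bF 0). Qed.

Let cont g : continuous (fun s => dot (F s) g : R^o).
Proof.
move=> s; apply/cvgrPdist_lt => e e0.
have g0 : 0 < `|g| + 1 by rewrite ltr_wpDl.
have e1 : 0 < e / (`|g| + 1) by rewrite divr_gt0.
have [d d0 h] := uF e1.
near=> t; rewrite -(dotBl ipd).
apply: le_lt_trans (cauchy_schwarz ipd _ _) _.
have : `|F s - F t| < e / (`|g| + 1).
  by apply: h; near: t; exact: (@cvgr_dist_lt _ R^o _ _ _ _ _ cvg_id).
rewrite ltr_pdivlMr//; apply: le_lt_trans.
by rewrite ler_wpM2l// lerDl.
Unshelve. all: by end_near. Qed.

Let integr g a b : leb.-integrable `[a, b] (EFin \o (fun s => dot (F s) g)).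
Proof.
apply: continuous_compact_integrable; first exact: segment_compact.
exact/continuous_subspaceT/cont.
Qed.

Let integr_cst (c a b : R) : leb.-integrable `[a, b] (EFin \o cst c).
Proof.
apply: continuous_compact_integrable; first exact: segment_compact.
by apply: continuous_subspaceT => x; exact: cvg_cst.
Qed.

Let length_itv (a b : R) : a <= b -> fine (leb `[a, b]) = b - a.
Proof.
move=> ab; rewrite lebesgue_measure_itv/= lte_fin.
by case: ltgtP ab => //= -> _; rewrite subrr.
Qed.

Let Rint_bound (f : R -> R) a b e : a <= b ->
  leb.-integrable `[a, b] (EFin \o f) ->
  (forall s, a <= s <= b -> f s <= e) ->
  \int[leb]_(s in `[a, b]) f s <= (b - a) * e.
Proof.
move=> ab fi fe; rewrite mulrC -(length_itv ab) -Rintegral_cst//.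
apply: le_Rintegral => //.
  exact: integr_cst.
Qed.

(** The premise a <= b stands under the existential, so that [choice] yields one function of all
    pairs (a, b). Riesz applies because the functional is bounded by (b - a) B. *)
Let ex_primitive a b : exists I : V, a <= b -> forall g,
  dot I g = \int[leb]_(s in `[a, b]) dot (F s) g.
Proof.
have [ab|_] := leP a b; last by exists 0.
suff [I hI] : exists I : V, forall g,
    dot g I = \int[leb]_(s in `[a, b]) dot (F s) g.
  by exists I => _ g; rewrite (dotC ipd).
apply: (riesz ipd (C := (b - a) * B) cV).
  move=> c u v _ _ /=.
  transitivity (\int[leb]_(s in `[a, b]) (c * dot (F s) u + dot (F s) v)).
    by apply: eq_Rintegral => s _; rewrite (dotDr ipd) (dotZr ipd).
  have iu := integr u a b; have iv := integr v a b.
  rewrite RintegralD//; last exact: (integrableZl _ c iu).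
  by rewrite RintegralZl.
move=> g /=; rewrite ler_norml; apply/andP; split.
  (* The lower bound is the upper bound for - g. *)
  rewrite lerNl.
  have -> : - (\int[leb]_(s in `[a, b]) dot (F s) g) =
      \int[leb]_(s in `[a, b]) dot (F s) (- g).
    transitivity (\int[leb]_(s in `[a, b]) (-1 * dot (F s) g)).
      by rewrite RintegralZl// mulN1r.
    by apply: eq_Rintegral => s _; rewrite (dotNr ipd) mulN1r.
  rewrite -mulrA; apply: Rint_bound => //.
  move=> s _; apply: le_trans (ler_norm _) _.
  apply: le_trans (cauchy_schwarz ipd _ _) _.
  by rewrite normrN ler_wpM2r.
rewrite -mulrA; apply: Rint_bound => //.
move=> s _; apply: le_trans (ler_norm _) _.
apply: le_trans (cauchy_schwarz ipd _ _) _.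
by rewrite ler_wpM2r.
Qed.

(* Tested against g, the primitive is a scalar Lebesgue integral; it exists by
   the Riesz representation theorem. *)
Lemma primitive_exists : exists G : R -> R -> V,
  (forall r s t, r <= s -> s <= t -> G r t = G r s + G s t) /\
  (forall s t v e, s <= t -> (forall r, s <= r <= t -> `|F r - v| <= e) ->
     `|G s t - (t - s) *: v| <= (t - s) * e).
Proof.
have [G GP] := choice (fun ab : R * R => ex_primitive ab.1 ab.2).
have {}GP a b : a <= b -> forall g, dot (G (a, b)) g =
    \int[leb]_(s in `[a, b]) dot (F s) g by move=> /(GP (a, b)).
exists (fun a b => G (a, b)); split.
- move=> r s t rs st; apply/eqP; rewrite -subr_eq0; apply/eqP.
  apply: (dot_eq0 ipd) => g; rewrite (dotBl ipd) (dotDl ipd) !GP//; last first.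
    exact: le_trans st.
  rewrite opprD addrA Rintegral_itvB ?bnd_simp//.
  rewrite Rintegral_itv_obnd_cbnd ?subrr//.
  by apply: integrableS (integr g s t) => //; exact: subset_itv_oc_cc.
- move=> s t v e st Fv.
  have e0 : 0 <= e by apply: le_trans (Fv s _); rewrite ?lexx.
  apply: (norm_le_dot ipd); first by rewrite mulr_ge0// subr_ge0.
  move=> g; rewrite (dotBl ipd) (dotZl ipd) GP//.
  rewrite -(length_itv st) mulrC -Rintegral_cst// -RintegralB//;
    last exact: integr_cst.
  rewrite (length_itv st) -mulrA; apply: Rint_bound => //.
    exact: (integrableB _ (integr g s t) (integr_cst _ s t)).
  move=> r /Fv h; rewrite -(dotBl ipd); apply: le_trans (ler_norm _) _.
  by apply: le_trans (cauchy_schwarz ipd _ _) _; rewrite ler_wpM2r.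
Qed.

End weak_integral.

(** * Generators of contraction semigroups *)

Section semigroup.
Context {R : realType} {V : normedModType R}.

Record contraction_semigroup (P : R -> V -> V) : Prop := ContractionSemigroup {
  sg0 : forall f, P 0 f = f;
  sgD : forall s t f, 0 <= s -> 0 <= t -> P (s + t) f = P s (P t f);
  sg_linear : forall t, 0 <= t -> linear_on [set: V] (P t);
  sg_contract : forall t f, 0 <= t -> `|P t f| <= `|f|;
  sg_cvg0 : forall f, P t f @[t --> 0^'+] --> f }.

Definition sg_dom (P : R -> V -> V) : set V :=
  [set f | cvg (t^-1 *: (P t f - f) @[t --> 0^'+])].

Definition sg_gen (P : R -> V -> V) (f : V) : V :=
  lim (t^-1 *: (P t f - f) @[t --> 0^'+]).

Definition sg_int (P : R -> V -> V) (t : R) (f : V) : V :=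
  riemann_integral (P ^~ f) 0 t.

Lemma cvg_bounded_linear {T} {F : set_system T} {FF : Filter F} (u : T -> V)
    (l : V) (A : V -> V) (C : R) :
  linear_on [set: V] A -> (forall f, `|A f| <= C * `|f|) ->
  u @ F --> l -> A (u x) @[x --> F] --> A l.
Proof.
move=> lA cA ul; apply/cvgrPdist_lt => e e0.
have C1 : 0 < `|C| + 1 by rewrite ltr_wpDl.
have e1 : 0 < e / (`|C| + 1) by rewrite divr_gt0.
have /cvgrPdist_lt/(_ _ e1) := ul; apply: filterS => x.
rewrite -(linear_onB lA)// ltr_pdivlMr// => h.
apply: le_lt_trans (cA _) _; apply: le_lt_trans h.
by rewrite mulrC ler_wpM2l// (le_trans (ler_norm C))// lerDl.
Qed.

Lemma right_cvg_unique (u : R -> V) (l l' : V) :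
  u t @[t --> 0^'+] --> l -> u t @[t --> 0^'+] --> l' -> l = l'.
Proof. by move=> ul ul'; exact: (cvg_unique _ ul ul'). Qed.

Lemma eq_right_cvg (u v : R -> V) (l : V) : (forall t, 0 < t -> u t = v t) ->
  u t @[t --> 0^'+] --> l -> v t @[t --> 0^'+] --> l.
Proof.
move=> uv; apply: cvg_trans; apply: near_eq_cvg.
by near=> t; rewrite uv//; near: t; exact: nbhs_right_gt.
Unshelve. all: by end_near. Qed.

Lemma right_cvg_lin a (u v : R -> V) (l l' : V) :
  u t @[t --> 0^'+] --> l -> v t @[t --> 0^'+] --> l' ->
  (a *: u t + v t) @[t --> 0^'+] --> a *: l + l'.
Proof. by move=> hu hv; apply: cvgD => //; exact: cvgZl_tmp. Qed.

Lemma right_cvgB (u v : R -> V) (l l' : V) :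
  u t @[t --> 0^'+] --> l -> v t @[t --> 0^'+] --> l' ->
  (u t - v t) @[t --> 0^'+] --> l - l'.
Proof. by move=> hu hv; exact: cvgB. Qed.

Variable P : R -> V -> V.
Hypothesis sgP : contraction_semigroup P.

Lemma sg_genP f l : t^-1 *: (P t f - f) @[t --> 0^'+] --> l ->
  sg_dom P f /\ sg_gen P f = l.
Proof.
move=> h; split; first by apply/cvg_ex; exists l.
exact: (cvg_lim _ h).
Qed.

Lemma sg_gen_cvg f : sg_dom P f ->
  t^-1 *: (P t f - f) @[t --> 0^'+] --> sg_gen P f.
Proof. by []. Qed.

Lemma sg_gen_lin a f g : sg_dom P f -> sg_dom P g ->
  sg_dom P (a *: f + g) /\ sg_gen P (a *: f + g) = a *: sg_gen P f + sg_gen P g.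
Proof.
move=> /sg_gen_cvg hf /sg_gen_cvg hg; apply: sg_genP.
apply: eq_right_cvg _ (right_cvg_lin (a := a) hf hg) => t t0 /=.
rewrite (sg_linear sgP (ltW t0))// opprD addrACA [RHS]scalerDr; congr (_ + _).
by rewrite -scalerBr !scalerA mulrC.
Qed.

Lemma sg_dom_subspace : linear_subspace (sg_dom P).
Proof.
split=> [|a f g Df Dg]; last by case: (sg_gen_lin a Df Dg).
apply: (proj1 (@sg_genP 0 0 _)).
apply: (@eq_right_cvg (cst 0)) => [t t0|]; last exact: cvg_cst.
by rewrite (linear_on0 linear_subspaceT (sg_linear sgP (ltW t0))) subr0 scaler0.
Qed.

Lemma sg_gen_linear : linear_on (sg_dom P) (sg_gen P).
Proof. by move=> a f g Df Dg; case: (sg_gen_lin a Df Dg). Qed.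

(** Continuity at 0 propagates: for s <= t, P s f - P t f = P s (f - P (t - s) f) and P s is a
    contraction, so the modulus does not depend on s. *)
Lemma sg_unif_cont f e : 0 < e -> exists2 d, 0 < d &
  forall s t, 0 <= s -> 0 <= t -> `|s - t| < d -> `|P s f - P t f| < e.
Proof.
move=> e0; have /cvgrPdist_lt/(_ _ e0) := @sg_cvg0 _ sgP f.
rewrite near_withinE near_simpl => /nbhs_ballP[d /= d0 h].
exists d => // s t.
wlog st : s t / s <= t.
  move=> W s0 t0; have [st|/ltW ts] := leP s t; first exact: W.
  by rewrite distrC (distrC (P s f)); exact: W.
move=> s0 t0; have [->|sNt] := eqVneq s t; first by move=> _; rewrite subrr normr0.
have ts0 : 0 < t - s by rewrite subr_gt0 lt_neqAle sNt.
move=> std; have -> : P t f = P s (P (t - s) f).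
  by rewrite -(sgD sgP)// ?ltW// addrC subrK.
rewrite -(linear_onB (sg_linear sgP s0))//.
apply: le_lt_trans (sg_contract sgP _ s0) _; apply: h => //.
by rewrite /ball/= sub0r normrN gtr0_norm// -(gtr0_norm ts0) distrC.
Qed.

Context {dot : V -> V -> R}.
Hypotheses (ipd : inner_product dot) (cV : cauchy_complete V).

Lemma sg_primitive f : exists G : R -> R -> V,
  [/\ forall r s t, r <= s -> s <= t -> G r t = G r s + G s t,
     forall s t v e, 0 <= s -> s <= t ->
       (forall r, s <= r <= t -> `|P r f - v| <= e) ->
       `|G s t - (t - s) *: v| <= (t - s) * e &
     forall s t, 0 <= s -> s <= t -> is_riemann_integral (P ^~ f) s t (G s t)].
Proof.
(* [primitive_exists] takes a function uniformly continuous on the whole line, so the orbit is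
   frozen at its initial value for negative times. *)
pose F s := P (Num.max 0 s) f.
have FE (s : R) : 0 <= s -> F s = P s f by move=> s0; rewrite /F max_r.
have m0 (s : R) : 0 <= Num.max 0 s by rewrite le_max lexx.
have uF (e : R) : 0 < e -> exists2 d, 0 < d & forall s t, `|s - t| < d ->
    `|F s - F t| < e.
  move=> /(sg_unif_cont f)[d d0 h]; exists d => // s t st.
  apply: h => //; apply: le_lt_trans st.
  rewrite ler_norml; have := ler_norm (s - t); have := ler_norm (t - s).
  rewrite distrC; have := normr_ge0 (s - t); rewrite /Num.max.
  by case: ifPn => s0; case: ifPn => t0 ? ? ?; apply/andP; split; lra.
have bF s : `|F s| <= `|f| by exact: (sg_contract sgP).
have [G [Gadd Gest]] := primitive_exists ipd cV uF bF.
exists G; split => //.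
- move=> s t v e s0 st h; apply: Gest => // r rst; rewrite FE; first exact: h.
  by case/andP: rst => sr _; exact: le_trans sr.
- move=> s t s0 st.
  apply: (@eq_is_riemann_integral _ _ F).
    by move=> r /andP[sr _]; rewrite FE//; exact: le_trans sr.
  exact: is_riemann_integral_primitive.
Qed.

Lemma sg_intP t f : 0 <= t -> is_riemann_integral (P ^~ f) 0 t (sg_int P t f).
Proof.
move=> t0; have [G [_ _ /(_ _ _ (lexx 0) t0) h]] := sg_primitive f.
by rewrite /sg_int (riemann_integralE t0 h).
Qed.

Lemma sg_intE t f I : 0 <= t -> is_riemann_integral (P ^~ f) 0 t I ->
  sg_int P t f = I.
Proof. exact: riemann_integralE. Qed.

Lemma sg_int_linear t : 0 <= t -> linear_on [set: V] (sg_int P t).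
Proof.
move=> t0 a f g _ _; apply: sg_intE => //.
apply: eq_is_riemann_integral _
  (is_riemann_integral_lin a (sg_intP f t0) (sg_intP g t0)).
by move=> s /andP[s0 _]; rewrite (sg_linear sgP s0).
Qed.

Lemma sg_int_est t v e f : 0 <= t ->
  (forall r, 0 <= r <= t -> `|P r f - v| <= e) ->
  `|sg_int P t f - t *: v| <= t * e.
Proof.
move=> t0 h; have [G [_ Gest GP]] := sg_primitive f.
rewrite (sg_intE t0 (GP _ _ (lexx 0) t0)).
by have := Gest 0 t v e (lexx 0) t0 h; rewrite subr0.
Qed.

Lemma sg_int_norm t f : 0 <= t -> `|sg_int P t f| <= t * `|f|.
Proof.
move=> t0; have := @sg_int_est t 0 `|f| f t0; rewrite scaler0 subr0; apply.
by move=> r /andP[r0 _]; rewrite subr0; exact: (sg_contract sgP).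
Qed.

(** P h carries the integral over [0, t] to the one over [h, t + h]. Written as a difference, it is
    ready for the difference quotient in [sg_int_dom]. *)
Lemma sg_sg_int h t f : 0 <= h -> 0 <= t ->
  P h (sg_int P t f) = sg_int P (t + h) f - sg_int P h f.
Proof.
move=> h0 t0; have [G [Gadd _ GP]] := sg_primitive f.
have th0 : 0 <= t + h by rewrite addr_ge0.
have hth : h <= t + h by rewrite lerDr.
rewrite (sg_intE th0 (GP _ _ (lexx 0) th0)) (sg_intE h0 (GP _ _ (lexx 0) h0)).
rewrite (Gadd 0 h)// addrC addKr.
apply: (is_riemann_integral_unique hth (F := P ^~ f)); last exact: GP.
rewrite -[X in is_riemann_integral _ X](add0r h).
apply: is_riemann_integral_shift.
apply: eq_is_riemann_integral _ (is_riemann_integral_map (sg_linear sgP h0)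
  (fun g => sg_contract sgP g h0) (sg_intP f t0)).
by move=> s /andP[s0 _] /=; rewrite addrC (sgD sgP).
Qed.

Lemma sg_int_sg h t f : 0 <= h -> 0 <= t ->
  sg_int P t (P h f) = P h (sg_int P t f).
Proof.
move=> h0 t0; apply: sg_intE => //.
apply: eq_is_riemann_integral _ (is_riemann_integral_map (sg_linear sgP h0)
  (fun g => sg_contract sgP g h0) (sg_intP f t0)).
by move=> s /andP[s0 _] /=; rewrite -!(sgD sgP)// addrC.
Qed.

Lemma sg_int_avg f : t^-1 *: sg_int P t f @[t --> 0^'+] --> f.
Proof.
apply/cvgrPdist_lt => e e0.
have e2 : 0 < e / 2 by rewrite divr_gt0.
have [d d0 h] := sg_unif_cont f e2.
near=> t.
have t0 : 0 < t by near: t; exact: nbhs_right_gt.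
have td : t < d by near: t; exact: nbhs_right_lt.
have est : `|sg_int P t f - t *: f| <= t * (e / 2).
  apply: sg_int_est; first exact: ltW.
  move=> r /andP[r0 rt]; rewrite -[X in _ - X](sg0 sgP); apply/ltW/h => //.
  by rewrite subr0 ger0_norm//; exact: le_lt_trans td.
have -> : f - t^-1 *: sg_int P t f = - (t^-1 *: (sg_int P t f - t *: f)).
  by rewrite scalerBr scalerA mulVf ?gt_eqF// scale1r opprB.
rewrite normrN normrZ gtr0_norm ?invr_gt0//.
apply: (@le_lt_trans _ _ (e / 2)); last by lra.
by rewrite ler_pdivrMl.
Unshelve. all: by end_near. Qed.

(** Writing I(t) for the integral over [0, t], both (P h - 1) I(t) and (P t - 1) I(h) equal I(t + h)
    - I(h) - I(t). So the difference quotient of I(t) is (P t - 1) applied to I(h) / h, which tends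
    to f. *)
Lemma sg_int_dom t f : 0 <= t ->
  sg_dom P (sg_int P t f) /\ sg_gen P (sg_int P t f) = P t f - f.
Proof.
move=> t0; apply: sg_genP.
have hP : P t (h^-1 *: sg_int P h f) @[h --> 0^'+] --> P t f.
  apply: (@cvg_bounded_linear _ _ _ _ _ _ 1) (@sg_int_avg f).
    exact: (sg_linear sgP).
  by move=> g; rewrite mul1r; exact: (sg_contract sgP).
apply: eq_right_cvg _ (right_cvgB hP (@sg_int_avg f)) => h h0 /=.
have sT := @linear_subspaceT R V.
rewrite (linear_onZ sT (sg_linear sgP t0))// -scalerBr; congr (_ *: _).
by rewrite !sg_sg_int ?(ltW h0)// (addrC t) addrAC.
Qed.

(** [sg_int P t] is bounded and commutes with P h, so it passes through the difference quotients of
    f; their images are the difference quotients of [sg_int P t f]. *)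
Lemma sg_int_gen t f : 0 <= t -> sg_dom P f -> sg_int P t (sg_gen P f) = P t f - f.
Proof.
move=> t0 Df; have [Dt <-] := sg_int_dom f t0.
apply: right_cvg_unique (sg_gen_cvg Dt).
have lt := sg_int_linear t0.
apply: eq_right_cvg _
  (cvg_bounded_linear lt (fun g => sg_int_norm g t0) (sg_gen_cvg Df)) => h h0 /=.
rewrite (linear_onZ linear_subspaceT lt)// (linear_onB lt)//.
by rewrite sg_int_sg// ltW.
Qed.

(** The integrated identity of [sg_int_gen] involves only bounded operators and survives the limit:
    P t f - f is the integral of the orbit of h. Dividing by t and letting t tend to 0 gives the
    claim. *)
Lemma sg_gen_closed (u : nat -> V) f h : (forall n, sg_dom P (u n)) ->
  u @ \oo --> f -> (sg_gen P \o u) @ \oo --> h -> sg_dom P f /\ sg_gen P f = h.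
Proof.
move=> Du uf uh; apply: sg_genP.
apply: eq_right_cvg _ (@sg_int_avg h) => t t0; congr (_ *: _).
have t0' := ltW t0.
have h1 : sg_int P t (sg_gen P (u n)) @[n --> \oo] --> sg_int P t h.
  exact: (cvg_bounded_linear (sg_int_linear t0') (fun g => sg_int_norm g t0') uh).
have cP g : `|P t g| <= 1 * `|g| by rewrite mul1r; exact: (sg_contract sgP).
have h2 : sg_int P t (sg_gen P (u n)) @[n --> \oo] --> P t f - f.
  have -> : (fun n => sg_int P t (sg_gen P (u n))) = (fun n => P t (u n) - u n).
    by apply/funext => n; rewrite sg_int_gen.
  by apply: cvgB => //; exact: (cvg_bounded_linear (sg_linear sgP t0') cP uf).
exact: (cvg_unique _ h1 h2).
Qed.

(** The approximants are time averages, which lie in the domain by [sg_int_dom]. *)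
Lemma sg_dom_dense f e : 0 < e ->
  exists2 t, 0 < t & `|f - t^-1 *: sg_int P t f| < e.
Proof.
move=> e0; have /cvgrPdist_lt/(_ _ e0) := @sg_int_avg f.
rewrite near_withinE near_simpl => /nbhs_ballP[d /= d0 h].
exists (d / 2); first by rewrite divr_gt0.
apply: h; last by rewrite divr_gt0.
by rewrite /ball/= sub0r normrN gtr0_norm ?divr_gt0//; lra.
Qed.

End semigroup.

(** * The space L^2(mu) *)

Section L2_inner_product.
Context d (T : measurableType d) (R : realType).
Variable mu : {measure set T -> \bar R}.
Implicit Types f g : L2 mu.

Lemma L2val_measurable f : measurable_fun [set: T] (L2val f).
Proof. by have := L2valP f; rewrite inE => /andP[]; rewrite inE. Qed.

Lemma L2_mul_integrable f g :
  mu.-integrable [set: T] (EFin \o (fun x => L2val f x * L2val g x)).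
Proof. by apply/Lfun1_integrable/Lfun2_mul_Lfun1; exact: L2valP. Qed.

Lemma eq_ae_Rintegral (a b : T -> R) : measurable_fun [set: T] a ->
  measurable_fun [set: T] b -> a = b %[ae mu] ->
  \int[mu]_x a x = \int[mu]_x b x.
Proof.
move=> ma mb ab; rewrite /Rintegral; congr fine.
apply: ae_eq_integral => //; [exact/measurable_EFinP..|].
by apply: filterS ab => x + Dx => /(_ Dx) /= ->.
Qed.

Lemma ip_inner_product : inner_product (@ip _ _ R mu).
Proof.
split.
- by move=> f g; apply: eq_Rintegral => x _; rewrite mulrC.
- move=> f g h; rewrite /ip -RintegralD//; try exact: L2_mul_integrable.
  apply: eq_ae_Rintegral.
  + by apply: measurable_funM; exact: L2val_measurable.
  + by apply: measurable_funD; apply: measurable_funM; exact: L2val_measurable.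
  + by apply: filterS (L2valD f g) => x /= /(_ I) -> _; rewrite mulrDl.
- move=> a f g; rewrite /ip -RintegralZl//; last exact: L2_mul_integrable.
  apply: eq_ae_Rintegral.
  + by apply: measurable_funM; exact: L2val_measurable.
  + apply: measurable_funM => //; apply: measurable_funM; exact: L2val_measurable.
  + by apply: filterS (L2valZ a f) => x /= /(_ I) -> _; rewrite mulrA.
- move=> f; apply/EFin_inj; rewrite /ip /Rintegral fineK; last first.
    exact: integrable_fin_num (L2_mul_integrable f f).
  rewrite -powR_mulrn// -poweR_EFin L2_normE.
  rewrite (finite_norm_fine (L2rep f)) poweR_Lnorm//.
  apply: eq_integral => x _ /=.
  by rewrite -[RHS]poweR_EFin ?poweR_EFin powR_mulrn// real_normK ?num_real.
Qed.

Lemma sqr_L2norm f : (`|f| ^+ 2)%:E = (\int[mu]_x (L2val f x ^+ 2)%:E)%E.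
Proof.
rewrite -(dotff ip_inner_product) /ip /Rintegral fineK; last first.
  exact: integrable_fin_num (L2_mul_integrable f f).
by apply: eq_integral => x _.
Qed.

Lemma Lfun2_of_sqr_integral (g : T -> R) : measurable_fun [set: T] g ->
  (\int[mu]_x (g x ^+ 2)%:E < +oo)%E -> g \in Lfun mu 2%:E.
Proof.
move=> mg gy; rewrite inE; apply/andP; split; rewrite inE//=.
rewrite /finite_norm unlock; apply: poweR_lty.
apply: le_lt_trans gy; apply: ge0_le_integral => //.
- by move=> x _; exact: poweR_ge0.
- apply: (measurableT_comp (measurable_poweR _)).
  by apply: measurableT_comp => //; exact/measurable_EFinP.
- by apply/measurable_EFinP; exact: measurable_funX.
- move=> x _ /=.
  rewrite -[X in (X <= _)%E]/(`|g x|%:E `^ 2)%E poweR_EFin powR_mulrn//.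
  by rewrite real_normK ?num_real.
Qed.

Lemma L2of_val (g : T -> R) : g \in Lfun mu 2%:E -> L2val (L2of mu g) = g %[ae mu].
Proof.
by move=> hg; rewrite /L2of; case: pselect => // h; exact: L2classK.
Qed.

Lemma L2valB f g : L2val (f - g) = (fun x => L2val f x - L2val g x) %[ae mu].
Proof.
have := L2valN g; have := L2valD f (- g).
by apply: filterS2 => x /= /(_ I) -> /(_ I) ->.
Qed.

End L2_inner_product.

(** * Completeness of L^2(mu) *)

Lemma limn_einf_ge {R : realType} (u : (\bar R)^nat) C :
  (forall n, (C <= u n)%E) -> (C <= limn_einf u)%E.
Proof.
move=> Cu; rewrite limn_einf_lim; apply: lime_ge; first exact: is_cvg_einfs.
by apply: nearW => n; apply: le_ereal_inf_tmp => _ [k _ <-].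
Qed.

Lemma limn_einf_le {R : realType} (u : (\bar R)^nat) C :
  (forall n, (u n <= C)%E) -> (limn_einf u <= C)%E.
Proof.
move=> uC; rewrite limn_einf_lim; apply: lime_le; first exact: is_cvg_einfs.
apply: nearW => n; apply: le_trans (uC n).
by apply: ereal_inf_lbound; exists n => /=.
Qed.

Lemma half_expr_lt {R : realType} (e : R) : 0 < e ->
  exists N : nat, 2^-1 ^+ N < e.
Proof.
move=> e0; have [N] := @ltr_add_invr R 0 _ e0; rewrite add0r => hN.
exists N.+1; apply: le_lt_trans hN.
rewrite exprVn lef_pV2 ?posrE ?exprn_gt0// -natrX ler_nat.
by apply: ltnW; exact: ltn_expl.
Qed.

Section L2_complete.
Context d (T : measurableType d) (R : realType).
Variable mu : probability T R.

(* Cauchy-Schwarz against the constant 1. *)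
Lemma L1norm_le_L2norm (f : L2 mu) :
  (\int[mu]_x `|(L2val f x)%:E| <= `|f|%:E)%E.
Proof.
have mf := L2val_measurable f.
have h2 : (2^-1 + 2^-1 : R) = 1 by rewrite [RHS]splitr !div1r.
have := hoelder mu mf (measurable_cst (1 : R)) (ltr0Sn R 1) (ltr0Sn R 1) h2.
rewrite (Lnorm_cst1 mu 2) [X in (X `^ _)%E](probability_setT mu) poweR1r mule1.
rewrite L2_normE.
rewrite (finite_norm_fine (L2rep f)); apply: le_trans; rewrite Lnorm1.
by under [leRHS]eq_integral do rewrite /= mulr1.
Qed.

(** Riesz-Fischer: the increments are summable in L^1, so the sequence converges almost everywhere;
    Fatou's lemma then shows that the pointwise limit is the L^2 limit. *)
Lemma L2_fast_cauchy_cvg (v : nat -> L2 mu) :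
  (forall m n, (m <= n)%N -> `|v m - v n| <= 2^-1 ^+ m) ->
  exists l : L2 mu, v @ \oo --> l.
Proof.
move=> vC.
pose h k x := `|L2val (v k.+1) x - L2val (v k) x|.
have mv k := L2val_measurable (v k).
have mh k : measurable_fun [set: T] (h k).
  by apply: measurableT_comp => //; exact: measurable_funB.
have mEh k : measurable_fun [set: T] (fun x => (h k x)%:E) by exact/measurable_EFinP.
have h0 k x : (0 <= (h k x)%:E)%E by rewrite lee_fin normr_ge0.
have sumh : (\int[mu]_x (\sum_(0 <= k <oo) (h k x)%:E) < +oo)%E.
  rewrite integral_nneseries//.
  (* 2^-k is written 2 / 2^(k+1), the shape summed by [epsilon_trick0]. *)
  apply: (@le_lt_trans _ _ (\sum_(0 <= k <oo) (2 / (2 ^ k.+1)%:R)%:E)%E).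
    apply: lee_nneseries => [k _ _|k _]; first by apply: integral_ge0.
    rewrite (_ : (2 / _) = 2^-1 ^+ k); last first.
      rewrite natrX exprS invfM mulrA divff ?pnatr_eq0// mul1r exprVn//.
    have := vC k k.+1 (leqnSn k); rewrite -lee_fin distrC; apply: le_trans.
    apply: le_trans (L1norm_le_L2norm _).
    rewrite le_eqVlt; apply/orP; left; apply/eqP; apply: ge0_ae_eq_integral => //.
    - by do 2 apply: measurableT_comp => //; exact: L2val_measurable.
    - apply: filterS (L2valB (v k.+1) (v k)) => x /= /(_ I) -> _.
      by [].
  by apply: le_lt_trans (epsilon_trick0 xpredT (ler0n R 2)) _; rewrite ltry.
have aecv : {ae mu, forall x, cvgn (fun k => L2val (v k) x)}.
  have /integrable_ae : mu.-integrable [set: T]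
      (fun x => \sum_(0 <= k <oo) (h k x)%:E)%E.
    apply/integrableP; split; first exact: ge0_emeasurable_sum.
    under eq_integral do rewrite gee0_abs ?nneseries_ge0//.
    exact: sumh.
  move=> /(_ measurableT); apply: filterS => x /(_ I) fin.
  suff : cvgn (series (fun k => L2val (v k.+1) x - L2val (v k) x)).
    rewrite (telescopeK (fun k => L2val (v k) x)) => /cvg_ex[l cl].
    apply/cvg_ex; exists (l + L2val (v 0%N) x).
    rewrite (_ : (fun k => L2val (v k) x) = fun k =>
        (L2val (v k) x - L2val (v 0%N) x) + L2val (v 0%N) x); last first.
      by apply/funext => k; rewrite subrK.
    by apply: cvgD => //; exact: cvg_cst.
  apply: (@normed_cvg R R^o); apply: nondecreasing_is_cvgn.
    by apply: nondecreasing_series => i _ _ /=; exact: normr_ge0.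
  exists (fine (\sum_(0 <= k <oo) (h k x)%:E)) => _ [n _ <-].
  rewrite -lee_fin fineK// /series/= -sumEFin.
  by apply: (@nneseries_lim_ge _ _ xpredT) => *; rewrite lee_fin.
(* A limsup is measurable without exceptional set and is the limit wherever there is one; [fine]
   removes infinite values, which occur only on the null set of divergence. *)
pose G x := limn_esup (fun k => (L2val (v k) x)%:E).
pose g x := fine (G x).
have mg : measurable_fun [set: T] g.
  apply: measurableT_comp => //; apply: measurable_fun_limn_esup => k.
  exact/measurable_EFinP.
have gcv : {ae mu, forall x, (fun k => L2val (v k) x) @ \oo --> g x}.
  apply: filterS aecv => x /cvg_ex[l cl].
  suff -> : g x = l by [].
  have /cvg_limn_einf_sup[_] : (fun k => (L2val (v k) x)%:E) @ \oo --> l%:E.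
    by apply: cvg_EFin; [exact: nearW|exact: cl].
  by rewrite /g /G => ->.
have bnd k : (\int[mu]_x ((g x - L2val (v k) x) ^+ 2)%:E <= ((2^-1 ^+ k) ^+ 2)%:E)%E.
  (* The shift by k makes the bound 2^-k on the distance to v k valid for every m. *)
  pose F m x := ((L2val (v (m + k)%N) x - L2val (v k) x) ^+ 2)%:E.
  have F0 m x : (0 <= F m x)%E by rewrite lee_fin sqr_ge0.
  have mF m : measurable_fun [set: T] (F m).
    apply/measurable_EFinP; apply: measurable_funX; exact: measurable_funB.
  apply: (@le_trans _ _ (\int[mu]_x limn_einf (F^~ x))%E).
    rewrite le_eqVlt; apply/orP; left; apply/eqP; apply: ge0_ae_eq_integral => //.
    - apply/measurable_EFinP; apply: measurable_funX; exact: measurable_funB.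
    - rewrite /limn_einf; apply: measurableT_comp => //.
      by apply: measurable_fun_limn_esup => n; exact: measurableT_comp.
    - by move=> x _; rewrite lee_fin sqr_ge0.
    - by move=> x _; exact: limn_einf_ge.
    - apply: filterS gcv => x cx _.
      suff /cvg_limn_einf_sup[-> _] : F^~ x @ \oo -->
        ((g x - L2val (v k) x) ^+ 2)%:E by [].
      apply: cvg_EFin; first exact: nearW.
      have cx' : (fun m => L2val (v (m + k)%N) x - L2val (v k) x) @ \oo -->
          g x - L2val (v k) x.
        by apply: cvgB; [by move: cx; rewrite -(cvg_shiftn k)|exact: cvg_cst].
      exact: (cvgM cx' cx').
  apply: le_trans (fatou mu measurableT mF _) _; first by move=> n x _.
  apply: limn_einf_le => m.
  rewrite (_ : (\int[mu]_x F m x)%E = (`|v (m + k)%N - v k| ^+ 2)%:E).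
    rewrite lee_fin ler_sqr ?nnegrE ?exprn_ge0// distrC.
    exact: vC (leq_addl m k).
  rewrite sqr_L2norm; apply: ge0_ae_eq_integral => //.
  - apply/measurable_EFinP; apply: measurable_funX; exact: L2val_measurable.
  - by move=> x _; rewrite lee_fin sqr_ge0.
  - by apply: filterS (L2valB (v (m + k)%N) (v k)) => x /= /(_ I) -> _.
(* Only differences g - v k are controlled, by [bnd], so the limit is assembled as v 0 plus the
   class of g - v 0. *)
have wL : (fun x => g x - L2val (v 0%N) x) \in Lfun mu 2%:E.
  apply: Lfun2_of_sqr_integral; first exact: measurable_funB.
  exact: le_lt_trans (bnd 0%N) (ltry _).
pose l := v 0%N + L2of mu (fun x => g x - L2val (v 0%N) x).
have lg : L2val l = g %[ae mu].
  have := L2valD (v 0%N) (L2of mu (fun x => g x - L2val (v 0%N) x)).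
  have := L2of_val wL; apply: filterS2 => x /= /(_ I) e1 /(_ I) e2 _.
  by rewrite e2 e1 addrC subrK.
have lv k : `|l - v k| <= 2^-1 ^+ k.
  rewrite -ler_sqr ?nnegrE ?exprn_ge0// -lee_fin sqr_L2norm.
  apply: le_trans (bnd k); rewrite le_eqVlt; apply/orP; left; apply/eqP.
  apply: ge0_ae_eq_integral => //.
  - apply/measurable_EFinP; apply: measurable_funX; exact: L2val_measurable.
  - apply/measurable_EFinP; apply: measurable_funX; exact: measurable_funB.
  - by move=> x _; rewrite lee_fin sqr_ge0.
  - by move=> x _; rewrite lee_fin sqr_ge0.
  - have := L2valB l (v k); move: lg; apply: filterS2.
    by move=> x /= /(_ I) e1 /(_ I) e2 _; rewrite e2 e1.
exists l; apply/cvgrPdist_lt => e /half_expr_lt[N hN].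
exists N => // k /= Nk; apply: le_lt_trans (lv k) _.
apply: le_lt_trans hN; by rewrite ler_wiXn2l ?invr_ge0// invf_le1// ler1n.
Qed.

Theorem L2_complete : cauchy_complete (L2 mu).
Proof.
move=> u uC.
have h0 k : 0 < 2^-1 ^+ k :> R by rewrite exprn_gt0.
have [N NP] := choice (fun k => uC _ (h0 k)).
(* A sum of thresholds dominates each of them, so the index n m is admissible for every precision
   2^-k with k <= m. *)
pose n k := (\sum_(j < k.+1) N j)%N.
have nN k m : (k <= m)%N -> (N k <= n m)%N.
  move=> km; rewrite /n (bigD1 (Ordinal (km : (k < m.+1)%N)))//=.
  exact: leq_addr.
have [l vl] : exists l : L2 mu, (u \o n) @ \oo --> l.
  by apply: L2_fast_cauchy_cvg => i j ij; apply/ltW/NP; exact: nN.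
exists l; apply/cvgrPdist_lt => e e0.
have e2 : 0 < e / 2 by rewrite divr_gt0.
have [K hK] := half_expr_lt e2.
have /cvgrPdist_lt/(_ _ e2)[K' _ hK'] := vl.
exists (N K) => // m /= Nm.
have h1 : `|l - u (n (maxn K K'))| < e / 2 by apply: hK'; exact: leq_maxr.
have h2 : `|u (n (maxn K K')) - u m| < 2^-1 ^+ K.
  by apply: NP => //; apply: nN; exact: leq_maxl.
apply: le_lt_trans (ler_distD (u (n (maxn K K'))) _ _) _; lra.
Qed.

End L2_complete.

(** * Markov semigroups on L^2(mu) *)

Section kernel_at.
Context d (T : measurableType d) (R : realType) (k : R.-pker T ~> T) (x : T).

(** Packages k x as a probability, so that it can serve as the law nu of [kernel_integral_comp] in
    the Chapman-Kolmogorov identity. *)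
Definition kernel_at : set T -> \bar R := k x.

HB.instance Definition _ := Measure.copy kernel_at (k x).
HB.instance Definition _ :=
  Measure_isProbability.Build _ _ _ kernel_at (prob_kernel x).

End kernel_at.

Section kernel_L2.
Context d (T : measurableType d) (R : realType).

Lemma ge0_integral_comp_kernel (nu : probability T R)
    (rho : {measure set T -> \bar R})
    (k : R.-pker T ~> T) (f : T -> \bar R) :
  (forall A, measurable A -> rho A = (\int[nu]_x k x A)%E) ->
  measurable_fun [set: T] f -> (forall x, 0 <= f x)%E ->
  (\int[rho]_x f x = \int[nu]_x \int[k x]_y f y)%E.
Proof.
move=> rhoE mf f0.
rewrite -(integral_kcomp (const_kernel nu) (snd_kernel k) tt f0 mf).
by apply: eq_measure_integral => A mA _; rewrite rhoE.
Qed.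

(** Covers two cases: rho = nu = mu is invariance, and rho = p (s + t) x with nu = p s x is
    Chapman-Kolmogorov. *)
Lemma kernel_integral_comp (nu : probability T R)
    (rho : {measure set T -> \bar R})
    (k : R.-pker T ~> T) (f : T -> R) :
  (forall A, measurable A -> rho A = (\int[nu]_x k x A)%E) ->
  rho.-integrable [set: T] (EFin \o f) ->
  \int[rho]_x f x = \int[nu]_x kernel_integral k f x.
Proof.
move=> rhoE fi; have [mf _] := integrableP _ _ _ fi.
have comp := ge0_integral_comp_kernel rhoE.
pose a x := (\int[k x]_y (EFin \o f)^\+ y)%E.
pose b x := (\int[k x]_y (EFin \o f)^\- y)%E.
have ma : measurable_fun [set: T] a.
  apply: measurable_fun_integral_kernel => //; last exact: measurable_funepos.
  by move=> U mU; exact: measurable_kernel.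
have mb : measurable_fun [set: T] b.
  apply: measurable_fun_integral_kernel => //; last exact: measurable_funeneg.
  by move=> U mU; exact: measurable_kernel.
have a0 x : (0 <= a x)%E by exact: integral_ge0.
have b0 x : (0 <= b x)%E by exact: integral_ge0.
have ae : (\int[rho]_x (EFin \o f)^\+ x = \int[nu]_x a x)%E.
  by apply: comp => //; exact: measurable_funepos.
have be : (\int[rho]_x (EFin \o f)^\- x = \int[nu]_x b x)%E.
  by apply: comp => //; exact: measurable_funeneg.
have ia : nu.-integrable [set: T] a.
  apply/integrableP; split => //; under eq_integral do rewrite gee0_abs//.
  rewrite -ae; have /integrableP[_] := integrable_funepos measurableT fi.
  by under eq_integral do rewrite gee0_abs//.
have ib : nu.-integrable [set: T] b.
  apply/integrableP; split => //; under eq_integral do rewrite gee0_abs//.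
  rewrite -be; have /integrableP[_] := integrable_funeneg measurableT fi.
  by under eq_integral do rewrite gee0_abs//.
rewrite /Rintegral; congr fine; rewrite integralE ae be -integralB//.
apply: ae_eq_integral => //.
- exact: emeasurable_funB.
- apply/measurable_EFinP; apply: (measurableT_comp (f := fine)) => //.
  rewrite (_ : (fun x => _) = (fun x => a x - b x)%E); last first.
    by apply/funext => x; rewrite -integralE.
  exact: emeasurable_funB.
(* The inner integrals of the positive and negative parts are finite only for almost every x; there
   [fine] loses nothing. *)
- have := integrable_ae measurableT ia; have := integrable_ae measurableT ib.
  apply: filterS2 => x /(_ I) bx /(_ I) ax _.
  rewrite /kernel_integral /Rintegral integralE -/(a x) -/(b x) fineK//.
  by rewrite fin_numB ax.
Qed.

Variables (mu : probability T R) (k : R.-pker T ~> T).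
Hypothesis ki : kernel_invariant mu k.

(** By invariance a mu-null set N satisfies k x N = 0 for almost every x. This is what lets k act on
    classes: changing a representative on N does not affect almost all of the integrals against k
    x. *)
Lemma kernel_ae (P : set T) : {ae mu, forall x, P x} ->
  {ae mu, forall x, {ae k x, forall y, P y}}.
Proof.
move=> [N [mN N0 sN]].
have mk := measurable_kernel k N mN.
have : (\int[mu]_x `|k x N| = 0)%E.
  by under eq_integral do rewrite gee0_abs//; rewrite ki.
move=> /(ae_eq_integral_abs mu measurableT mk).
by apply: filterS => x /(_ I) kx; exists N.
Qed.

Lemma kernel_ae_integrable (f : T -> R) : f \in Lfun mu 2%:E ->
  {ae mu, forall x, (k x).-integrable [set: T] (EFin \o f)}.
Proof.
move=> f2; have f1 : f \in Lfun mu 1.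
  by apply: Lfun_subset12 f2; rewrite [X in X \is a fin_num](probability_setT mu).
have /integrableP[mf fy] := (Lfun1_integrable mu f).1 f1.
have mf' : measurable_fun [set: T] (fun y => `|(EFin \o f) y|%E).
  exact: measurableT_comp.
have : mu.-integrable [set: T] (fun x => \int[k x]_y `|(EFin \o f) y|)%E.
  apply/integrableP; split.
    apply: measurable_fun_integral_kernel => //.
    by move=> U mU; exact: measurable_kernel.
  under eq_integral do rewrite gee0_abs ?integral_ge0//.
  by rewrite (ge0_integral_kernel ki).
move/(integrable_ae measurableT); apply: filterS => x /(_ I) fin.
by apply/integrableP; split => //; rewrite ltey_eq fin.
Qed.

Definition kernel_op (f : L2 mu) : L2 mu :=
  L2of mu (kernel_integral k (L2val f)).

Lemma kernel_opE f : L2val (kernel_op f) = kernel_integral k (L2val f) %[ae mu].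
Proof. by apply/L2of_val/kernel_integral_Lfun => //; exact: L2valP. Qed.

Lemma kernel_op_linear : linear_on [set: L2 mu] kernel_op.
Proof.
move=> a f g _ _; apply/L2_eqP.
have e1 := kernel_opE (a *: f + g).
have e2 := L2valD (a *: kernel_op f) (kernel_op g).
have e3 := L2valZ a (kernel_op f).
have ef := kernel_opE f; have eg := kernel_opE g.
have fi := kernel_ae_integrable (L2valP f).
have gi := kernel_ae_integrable (L2valP g).
have sumE : L2val (a *: f + g) = (fun x => a * L2val f x + L2val g x) %[ae mu].
  have := L2valZ a f; have := L2valD (a *: f) g.
  by apply: filterS2 => x /= /(_ I) -> /(_ I) ->.
have ek := kernel_ae sumE.
apply: filter_app ek; apply: filter_app e1; apply: filter_app e2.
apply: filter_app e3.
apply: filter_app ef; apply: filter_app eg; apply: filter_app fi.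
apply: filterS gi => x gi fi /(_ I) eg /(_ I) ef /(_ I) e3 /(_ I) e2 /(_ I) e1.
move=> ek _; rewrite e1 e2 e3 ef eg /kernel_integral.
rewrite -RintegralZl// -RintegralD//; last exact: (integrableZl _ a fi).
apply: eq_ae_Rintegral => //; first exact: L2val_measurable.
by apply: measurable_funD; [apply: measurable_funM => //|]; exact: L2val_measurable.
Qed.

(** Jensen's inequality for each k x, in the form [kernel_integral_sqr_le], followed by invariance
    of mu. *)
Lemma kernel_op_contract (f : L2 mu) : `|kernel_op f| <= `|f|.
Proof.
rewrite -ler_sqr ?nnegrE// -lee_fin !sqr_L2norm.
have msq (h : T -> R) : measurable_fun [set: T] h ->
    measurable_fun [set: T] (fun x => (h x ^+ 2)%:E).
  by move=> mh; apply/measurable_EFinP; exact: measurable_funX.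
have sq0 (h : T -> R) x : (0 <= (h x ^+ 2)%:E)%E by rewrite lee_fin sqr_ge0.
have mf := L2val_measurable f.
have := kernel_integral_Lfun ki (L2valP f).
rewrite inE => /andP[]; rewrite inE/= => mkf _.
rewrite (@ge0_ae_eq_integral _ _ _ _ _ _
    (fun x => (kernel_integral k (L2val f) x ^+ 2)%:E)) //; last first.
- by apply: filterS (kernel_opE f) => x /(_ I) -> _.
- exact: msq.
- by apply: msq; exact: L2val_measurable.
rewrite -(ge0_integral_kernel ki)//; last exact: msq.
have E (r : R) : ((r ^+ 2)%:E = `|r%:E| `^ 2)%E.
  rewrite -[X in (X `^ _)%E]/(`|r|%:E)%E poweR_EFin powR_mulrn//.
  by rewrite real_normK ?num_real.
apply: ge0_le_integral => //.
- exact: msq.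
- apply: measurable_fun_integral_kernel => //; last exact: msq.
  by move=> U mU; exact: measurable_kernel.
- move=> x _; rewrite E; apply: le_trans (kernel_integral_sqr_le _ _ mf) _.
  by under eq_integral do rewrite -E.
Qed.

Lemma kernel_op_mean (f : L2 mu) :
  \int[mu]_x L2val (kernel_op f) x = \int[mu]_x L2val f x.
Proof.
have f1 : L2val f \in Lfun mu 1.
  apply: Lfun_subset12 (L2valP f).
  by rewrite [X in X \is a fin_num](probability_setT mu).
rewrite [RHS](@kernel_integral_comp mu mu k)//; last 2 first.
- by move=> A mA; rewrite ki.
- exact/Lfun1_integrable.
have := kernel_integral_Lfun ki (L2valP f).
rewrite inE => /andP[]; rewrite inE/= => mkf _.
by apply: eq_ae_Rintegral => //; [exact: L2val_measurable|exact: kernel_opE].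
Qed.

End kernel_L2.

Section Psg.
Context d (T : measurableType d) (R : realType) (mu : probability T R).
Variable p : R -> R.-pker T ~> T.
Hypotheses (tp : transition_function p) (inv_mu : invariant_measure mu p).

Lemma Psg0 (f : L2 mu) : Psg p 0 f = f.
Proof.
apply/L2_eqP; apply: ae_eq_trans (kernel_opE (inv_mu (lexx 0)) f) _.
apply: nearW => x _; rewrite /kernel_integral /Rintegral.
rewrite (eq_measure_integral (\d_x)); last by move=> A mA _; exact: tp.1.
rewrite integral_dirac ?diracT ?mul1e//.
by apply/measurable_EFinP; exact: L2val_measurable.
Qed.

Lemma PsgD s t (f : L2 mu) : 0 <= s -> 0 <= t ->
  Psg p (s + t) f = Psg p s (Psg p t f).
Proof.
move=> s0 t0; have st0 : 0 <= s + t by rewrite addr_ge0.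
apply/L2_eqP; have e1 := kernel_opE (inv_mu st0) f.
have e2 := kernel_opE (inv_mu s0) (Psg p t f).
have e3 := kernel_ae (inv_mu s0) (kernel_opE (inv_mu t0) f).
have fi := kernel_ae_integrable (inv_mu st0) (L2valP f).
apply: filter_app e1; apply: filter_app e2; apply: filter_app e3.
apply: filterS fi => x fi e3 /(_ I) e2 /(_ I) e1 _.
rewrite e1 e2 /kernel_integral.
rewrite (@kernel_integral_comp _ _ _ (kernel_at (p s) x) (p (s + t) x) (p t))//.
- apply: eq_ae_Rintegral => //; last first.
  + by apply: filterS e3 => y h /h ->.
  + exact: L2val_measurable.
  have := kernel_integral_Lfun (inv_mu t0) (L2valP f).
  by rewrite inE => /andP[]; rewrite inE.
- by move=> A mA; exact: tp.2.
Qed.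

Lemma Psg_contraction_semigroup : strongly_continuous mu p ->
  contraction_semigroup (Psg p : R -> L2 mu -> L2 mu).
Proof.
split.
- exact: Psg0.
- by move=> s t f s0 t0; exact: PsgD.
- by move=> t t0; exact: kernel_op_linear (inv_mu t0).
- by move=> t f t0; exact: kernel_op_contract (inv_mu t0) f.
- by [].
Qed.

Lemma Psg_L20 t (f : L2 mu) : 0 <= t -> L20 mu f -> L20 mu (Psg p t f).
Proof. by move=> t0 f0; rewrite /L20/= (kernel_op_mean (inv_mu t0)). Qed.

End Psg.

(** * The second-order collapse *)

Lemma core_norm_le {R : realType} {V : normedModType R} (L : V -> V)
    (Dom D : set V) (c : R) : 0 <= c -> core L Dom D ->
  (forall f, D f -> `|f| <= c * `|L f|) -> forall f, Dom f -> `|f| <= c * `|L f|.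
Proof.
move=> c0 [_ _ dense] h f /dense{}dense; apply/ler_addgt0Pl => e e0.
have c1 : 0 < c + 1 by lra.
(* With this precision the total error |f - g| + c |L f - L g| stays below e. *)
have [g Dg [fg Lfg]] := dense (e / (c + 1)) (divr_gt0 e0 c1).
have := h g Dg; have := ler_normD (f - g) g; rewrite subrK.
have : `|L g| <= `|L f| + `|L f - L g|.
  by rewrite distrC -lerBlDl; exact: le_trans (lerB_dist _ _) _.
move: fg Lfg; move: (`|f - g|) (`|L f - L g|) => x y.
rewrite !ltr_pdivlMr// => hx hy h1 h2 h3; nra.
Qed.

(** Every Riemann sum is orthogonal to g. With g the constant 1 this keeps time averages inside
    L^2_0. *)
Lemma is_riemann_integral_dot0 {R : realType} {V : normedModType R}
    (dot : V -> V -> R) (F : R -> V) (a b : R) (I g : V) :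
  inner_product dot -> a <= b -> is_riemann_integral F a b I ->
  (forall s, a <= s <= b -> dot (F s) g = 0) -> dot I g = 0.
Proof.
move=> ipd ab FI F0; apply/eqP; rewrite -normr_eq0 eq_le normr_ge0 andbT.
apply/ler_addgt0Pl => e e0; rewrite addr0.
have g1 : 0 < `|g| + 1 by rewrite ltr_wpDl.
have [d d0 h] := FI _ (divr_gt0 e0 g1).
have [n [x [xi [tp mesh]]]] := tagged_partition_exists ab d0.
have := h n x xi tp mesh; set S := \sum_(i < n) _ => hS.
have S0 : dot S g = 0.
  rewrite /S (big_morph (dot ^~ g) (fun u v => dotDl ipd u v g) (dot0l ipd g)).
  apply: big1 => i _; rewrite (dotZl ipd) F0 ?mulr0//.
  exact: tagged_partition_tag tp _ _.
rewrite -[X in `|X|]opprK -[X in - X]add0r -S0 -(dotBl ipd) normrN.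
apply: le_trans (cauchy_schwarz ipd _ _) _.
move: hS; rewrite ltr_pdivlMr// => /ltW; apply: le_trans.
by rewrite ler_wpM2l// lerDl.
Qed.

(** If x > a + b then x^2 > (a + b) x >= a^2 + b x. It turns the quadratic estimate on the core into
    a linear one. *)
Lemma le_add_of_sqr_le {R : realType} (a b x : R) : 0 <= a -> 0 <= b ->
  x ^+ 2 <= a ^+ 2 + b * x -> x <= a + b.
Proof. by move=> a0 b0 h; rewrite leNgt; apply/negP => ?; nra. Qed.

(** A priori bound for the Lax-Milgram solution: a, b, c stand for |L g|^2, |g|, |u|. Expanding (m b
    - c)^2 >= 0 avoids dividing by b, which may be 0. *)
Lemma mul_le_sqr_of_mul_le {R : realType} (m a b c : R) : 0 < m ->
  a <= b * c -> m * b ^+ 2 <= a -> m * a <= c ^+ 2.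
Proof.
move=> m0 abc mba.
have h1 := ler_wpM2l (ltW m0) abc; have h2 := ler_wpM2l (ltW m0) mba.
have := sqr_ge0 (m * b - c); rewrite sqrrB exprMn; lra.
Qed.

(* Young's inequality, absorbing U ^+ 2 / 2 on the left. *)
Lemma sqr_le_of_young {R : realType} (m C U W G K : R) : 0 < m ->
  U ^+ 2 <= W * G + C * K * U -> m * G ^+ 2 <= U ^+ 2 ->
  U ^+ 2 <= 2 / m * W ^+ 2 + 2 * C ^+ 2 * K ^+ 2.
Proof.
move=> m0 hU hG.
(* The weight m / 4 makes the term in G cost U^2 / 4 by [hG]; splitting C K U as C^2 K^2 + U^2 / 4
   costs the other quarter. *)
have h1 : W * G <= m^-1 * W ^+ 2 + m / 4 * G ^+ 2.
  have : 0 <= m^-1 * (W - m / 2 * G) ^+ 2.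
    by rewrite mulr_ge0 ?sqr_ge0// invr_ge0 ltW.
  suff -> : m^-1 * (W - m / 2 * G) ^+ 2 =
    m^-1 * W ^+ 2 + m / 4 * G ^+ 2 - W * G by rewrite subr_ge0.
  by field; rewrite gt_eqF.
have := sqr_ge0 (C * K - U / 2); move: hU h1 hG; rewrite sqrrB !exprMn.
move: (m^-1) => i; lra.
Qed.

(* Read F, U, K, W, L as the norms of f, Pi f, f - Pi f, Lf + g (f - Pi f), Lf and
   a, b as the inner products of Lf with Pi f and f - Pi f. *)
Lemma hypocoercive_arith {R : realType} (M m C g F U K W L a b : R) :
  0 <= g -> 0 <= M -> 2 / m <= M -> 1 + 2 * C ^+ 2 <= M * g ^+ 2 ->
  F ^+ 2 = U ^+ 2 + K ^+ 2 -> U ^+ 2 <= 2 / m * W ^+ 2 + 2 * C ^+ 2 * K ^+ 2 ->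
  W ^+ 2 = L ^+ 2 + 2 * g * b + g ^+ 2 * K ^+ 2 ->
  g * K ^+ 2 <= - (a + b) -> - a <= L * U -> 0 <= L -> U <= F ->
  F ^+ 2 <= M * (L ^+ 2 + 2 * g * L * F).
Proof.
move=> g0 M0 M1 M2 F2 U2 W2 hK ha L0 UF.
(* Origin of M: F^2 = U^2 + K^2 is at most (2 / m) W^2 + (1 + 2 C^2) K^2, and M dominates the first
   coefficient while M g^2 dominates the second. *)
apply: (@le_trans _ _ (M * (W ^+ 2 + g ^+ 2 * K ^+ 2))).
  have := ler_wpM2r (sqr_ge0 W) M1; have := ler_wpM2r (sqr_ge0 K) M2.
  move: U2; rewrite F2; move: (W ^+ 2) (K ^+ 2) (U ^+ 2) (2 / m) (C ^+ 2) (g ^+ 2).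
  move=> x y z t u v.
  clear; lra.
(* The bracket is L^2 + 2 g b + 2 g^2 K^2; using g K^2 <= - (a + b) for the last term cancels b and
   leaves L^2 - 2 g a. *)
rewrite ler_wpM2l// W2.
have h1 : g * (- a) <= g * (L * F).
  by rewrite ler_wpM2l//; apply: le_trans ha _; rewrite ler_wpM2l.
have := ler_wpM2l g0 hK; move: h1; clear; lra.
Qed.

Section L20_theory.
Context d (T : measurableType d) (R : realType) (mu : probability T R).

Let one : L2 mu := L2of mu (cst 1).

Let L20E (f : L2 mu) : L20 mu f = (ip f one = 0).
Proof.
rewrite /L20/=; congr (_ = _); apply: eq_ae_Rintegral.
- exact: L2val_measurable.
- by apply: measurable_funM; exact: L2val_measurable.
- have := L2of_val (Lfun_cst mu 1 2).
  by apply: filterS => x /(_ I) /= -> _; rewrite mulr1.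
Qed.

Lemma L20_subspace : linear_subspace (L20 mu).
Proof.
have ipd := ip_inner_product mu.
split=> [|a u v]; rewrite !L20E; first exact: dot0l.
by move=> u0 v0; rewrite (dotDl ipd) (dotZl ipd) u0 v0 mulr0 addr0.
Qed.

Lemma L20_riemann_integral (F : R -> L2 mu) a b I : a <= b ->
  is_riemann_integral F a b I -> (forall s, a <= s <= b -> L20 mu (F s)) ->
  L20 mu I.
Proof.
move=> ab FI F0; rewrite L20E.
apply: (is_riemann_integral_dot0 (ip_inner_product mu) ab FI) => s.
by move=> /F0; rewrite L20E.
Qed.

End L20_theory.

Section second_order_collapse.
Context d (T : measurableType d) (R : realType) (mu : probability T R).
Variable p : R -> R.-pker T ~> T.
Variables (Hl Hh D0 : set (L2 mu)) (Pi : L2 mu -> L2 mu) (gamma m2 C2 : R).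
Hypotheses (tp : transition_function p) (inv_mu : invariant_measure mu p)
  (sc : strongly_continuous mu p).
Hypotheses (sHl : linear_subspace Hl) (cHl : closed Hl) (Hl0 : Hl `<=` L20 mu)
  (sHh : linear_subspace Hh) (Hh0 : Hh `<=` L20 mu)
  (HlHh : forall u k, Hl u -> Hh k -> ip u k = 0)
  (decomp : forall f, L20 mu f -> exists u k, [/\ Hl u, Hh k & f = u + k])
  (PiP : orthogonal_projection Hl Pi)
  (coreD0 : core (gen p) (gen_dom p `&` L20 mu) D0)
  (PiD0 : Pi @` D0 `<=` D0)
  (coreD0l : core (gen p) (gen_dom p `&` Hl) (D0 `&` Hl)).
Hypotheses (gamma0 : 0 < gamma) (m20 : 0 < m2) (C20 : 0 < C2)
  (coercive : forall f, D0 f -> - ip f (gen p f) >= gamma * `|f - Pi f| ^+ 2)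
  (macro : forall f, (D0 `&` Hl) f -> `|gen p f| ^+ 2 >= m2 * `|f| ^+ 2)
  (bounded : forall f g, (D0 `&` Hh) f -> collapse2_dom p Hl g ->
     ip (opA p gamma Pi f) (opA p gamma Pi g) <=
     C2 * `|f| * `|collapse2 p Hl g|).

Let ipd := ip_inner_product mu.
Let cV : cauchy_complete (L2 mu) := @L2_complete _ _ _ mu.
Let sgP := Psg_contraction_semigroup tp inv_mu sc.
Let sDom : linear_subspace (gen_dom p : set (L2 mu)) := sg_dom_subspace sgP.
Let linL : linear_on (gen_dom p) (gen p : L2 mu -> L2 mu) := sg_gen_linear sgP.

Lemma L20_sg_int t (f : L2 mu) : 0 <= t -> L20 mu f -> L20 mu (sg_int (Psg p) t f).
Proof.
move=> t0 f0.
apply: L20_riemann_integral t0 (sg_intP sgP ipd cV f t0) _ => s /andP[s0 _].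
exact: Psg_L20.
Qed.

Lemma time_avg_dom t (f : L2 mu) : 0 < t -> L20 mu f ->
  [/\ gen_dom p (time_avg p t f), L20 mu (time_avg p t f) &
      gen p (time_avg p t f) = t^-1 *: (Psg p t f - f)].
Proof.
move=> t0 f0; have [Dt Lt] := sg_int_dom sgP ipd cV f (ltW t0); split.
- exact: subspaceZ sDom _ _ Dt.
- by apply: (subspaceZ (L20_subspace mu)); apply: L20_sg_int => //; exact: ltW.
- by rewrite -Lt; exact: (linear_onZ sDom linL).
Qed.

(** Density of D0 in L^2_0 in dual form. A time average approximates w from the domain, an element g
    of D0 approximates that average, and orthogonality gives |w|^2 = <w - g, w>. *)
Lemma D0_dense (w : L2 mu) : L20 mu w -> (forall f, D0 f -> ip f w = 0) -> w = 0.
Proof.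
move=> w0 D0w; apply/eqP; rewrite -normr_eq0 eq_le normr_ge0 andbT.
apply/ler_addgt0Pl => e e0; rewrite addr0.
have e2 : 0 < e / 2 by rewrite divr_gt0.
have [t t0 wt] := sg_dom_dense sgP ipd cV w e2.
have [Dt Lt _] := time_avg_dom t0 w0.
have [_ _ /(_ _ (conj Dt Lt) _ e2)[g D0g [tg _]]] := coreD0.
have : ip (w - g) w = `|w| ^+ 2 by rewrite (dotBl ipd) (D0w g)// subr0 (dotff ipd).
have := cauchy_schwarz ipd (w - g) w => /(le_trans (ler_norm _)) + E.
rewrite E expr2; have [->|wn0] := eqVneq w 0; first by rewrite normr0 (ltW e0).
rewrite ler_pM2r ?normr_gt0// => /le_trans; apply.
apply: le_trans (ler_distD (time_avg p t w) _ _) _.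
have {}wt : `|w - time_avg p t w| < e / 2 by [].
lra.
Qed.

(** [Pi] is known only through its defining property, so its values are found by uniqueness: Pi f -
    v lies in H^l and is orthogonal to it. *)
Lemma Pi_eq f v : L20 mu f -> Hl v -> (forall h, Hl h -> ip (f - v) h = 0) ->
  Pi f = v.
Proof.
move=> f0 Hv hv; have [HPi hPi] := PiP f0.
apply/eqP; rewrite -subr_eq0; apply/eqP.
have Hd : Hl (Pi f - v) by exact: subspaceB.
have : ip (Pi f - v) (Pi f - v) = 0.
  have {1}-> : Pi f - v = (f - v) - (f - Pi f).
    by rewrite opprB [RHS]addrC addrA subrK.
  by rewrite (dotBl ipd) hv// hPi// subrr.
by rewrite (dotff ipd) => /eqP; rewrite sqrf_eq0 normr_eq0 => /eqP.
Qed.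

Lemma Pi_Hl f : Hl f -> Pi f = f.
Proof.
move=> Hf; apply: Pi_eq => // [|h _]; first exact: Hl0.
by rewrite subrr (dot0l ipd).
Qed.

Lemma Pi_Hh f : Hh f -> Pi f = 0.
Proof.
move=> Hf; apply: Pi_eq => //; [exact: Hh0|exact: sHl.1|].
by move=> h Hh'; rewrite subr0 (dotC ipd) HlHh.
Qed.

Lemma sub_Pi_Hh f : L20 mu f -> Hh (f - Pi f).
Proof.
move=> f0; have [u [k [Hu Hk fE]]] := decomp f0.
rewrite (@Pi_eq f u)// fE addrAC subrr add0r// => h Hh'.
by rewrite (dotC ipd) HlHh.
Qed.

(** The difference h - h' lies in H^l and is orthogonal to Dom(L) /\ H^l. For f in D0 its product
    with f equals that with Pi f, again in D0 and in H^l, hence vanishes; [D0_dense] concludes. *)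
Lemma collapse2_rel_unique g h h' :
  collapse2_rel p Hl g h -> collapse2_rel p Hl g h' -> h = h'.
Proof.
move=> [_ _ Hh1 E1] [_ _ Hh2 E2']; apply/eqP; rewrite -subr_eq0; apply/eqP.
have Hd : Hl (h - h') by exact: subspaceB.
apply: D0_dense; first exact: Hl0.
move=> f D0f; have [_ sD _] := coreD0; have [Df f0] := sD f D0f.
have [HPi /(_ _ Hd) hPi] := PiP f0.
have D0Pi : D0 (Pi f) by apply: PiD0; exists f.
have [DPi _] := sD _ D0Pi.
move: hPi; rewrite (dotBl ipd) => /eqP; rewrite subr_eq0 => /eqP ->.
by rewrite (dotBr ipd) -E1// -E2'// subrr.
Qed.

Lemma collapse2E g h : collapse2_rel p Hl g h -> collapse2 p Hl g = - h.
Proof.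
move=> gh; rewrite /collapse2; congr (- _).
apply: (collapse2_rel_unique _ gh).
exact: (xgetPex (0 : L2 mu) (ex_intro _ h gh)).
Qed.

(** Coercivity of the form on its full domain, as Lax-Milgram requires; square roots are taken
    because [core_norm_le] transports estimates of norms. *)
Lemma macro_dom f : gen_dom p f -> Hl f -> m2 * `|f| ^+ 2 <= `|gen p f| ^+ 2.
Proof.
move=> Df Hf; have s0 : 0 < Num.sqrt m2 by rewrite sqrtr_gt0.
have : `|f| <= (Num.sqrt m2)^-1 * `|gen p f|.
  apply: (core_norm_le _ coreD0l) => [|g D0g|//]; first by rewrite invr_ge0 ltW.
  rewrite ler_pdivlMl// -ler_sqr ?nnegrE ?mulr_ge0 ?(ltW s0)//.
  by rewrite exprMn sqr_sqrtr ?macro// ltW.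
rewrite ler_pdivlMl// -ler_sqr ?nnegrE ?mulr_ge0 ?(ltW s0)//.
by rewrite exprMn sqr_sqrtr// ltW.
Qed.

Lemma collapse2_solve u : Hl u -> exists g, collapse2_rel p Hl g u.
Proof.
move=> Hu; have s0 : 0 < Num.sqrt m2 by rewrite sqrtr_gt0.
pose D := gen_dom p `&` Hl.
have sD : linear_subspace D.
  split; first by split; [exact: sDom.1|exact: sHl.1].
  by move=> a v w [? ?] [? ?]; split; [exact: sDom.2|exact: sHl.2].
have [g [Dg Hg] gP] : exists2 g, D g &
    forall f, D f -> ip (gen p f) (gen p g) = ip f u.
  (* The constant comes from |<f, u>| <= |f| |u| and |f| <= |L f| / sqrt m2. *)
  apply: (@lax_milgram _ _ _ ipd D (gen p) (fun f => ip f u) m2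
    (`|u| / Num.sqrt m2)) => //.
  - by move=> a v w [? _] [? _]; exact: linL.
  - by move=> a v w _ _; rewrite (dotDl ipd) (dotZl ipd).
  - move=> v f h Dv vf vh.
    have [Df Lf] := sg_gen_closed sgP ipd cV (fun n => (Dv n).1) vf vh.
    split => //; split => //; apply: (closed_cvg _ cHl _ _ vf).
    by apply: nearW => n; exact: (Dv n).2.
  - by move=> f [? ?]; exact: macro_dom.
  - move=> f [Df Hf]; apply: le_trans (cauchy_schwarz ipd _ _) _.
    rewrite mulrC -mulrA ler_wpM2l//.
    rewrite ler_pdivlMl// -ler_sqr ?nnegrE ?mulr_ge0 ?(ltW s0)//.
    by rewrite exprMn sqr_sqrtr ?macro_dom// ltW.
by exists g; split => // f Df Hf; exact: gP.
Qed.

Let M := Num.max (2 / m2) ((1 + 2 * C2 ^+ 2) / gamma ^+ 2).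

Lemma D0_sqr_bound f : D0 f ->
  `|f| ^+ 2 <= M * (`|gen p f| ^+ 2 + 2 * gamma * `|gen p f| * `|f|).
Proof.
move=> D0f; have [sD0 sD _] := coreD0; have [Df f0] := sD f D0f.
pose u := Pi f; pose k := f - u.
have D0u : D0 u by apply: PiD0; exists f.
have [Du _] := sD u D0u.
have D0k : D0 k by exact: subspaceB.
have [Dk _] := sD k D0k.
have Hu : Hl u by case: (PiP f0).
have Hk : Hh k by exact: sub_Pi_Hh.
have [g gu] := collapse2_solve Hu; have [Dg Hg _ gE] := gu.
have fE : f = u + k by rewrite /k addrC subrK.
have uk : ip u k = 0 by exact: HlHh.
have Nf : `|f| ^+ 2 = `|u| ^+ 2 + `|k| ^+ 2.
  by rewrite {1}fE (sqr_normD ipd) uk mulr0 addr0.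
have D0Nk : (D0 `&` Hh) (- k).
  by rewrite -scaleN1r; split; exact: subspaceZ.
have AE : opA p gamma Pi g = gen p g.
  by rewrite /opA Pi_Hl// subrr scaler0 subr0.
have AkE : opA p gamma Pi (- k) = - (gen p k + gamma *: k).
  rewrite /opA Pi_Hh; last by case: D0Nk.
  rewrite sub0r opprK -scaleN1r (linear_onZ sDom linL)// scaleN1r.
  by rewrite opprD.
have := bounded D0Nk (ex_intro _ u gu).
rewrite AE AkE (collapse2E gu) !normrN (dotNl ipd) => hA.
pose W := gen p f + gamma *: k.
have Nu : `|u| ^+ 2 = ip W (gen p g) - ip (gen p k + gamma *: k) (gen p g).
  rewrite -(dotff ipd) -(gE u Du Hu) /E2 -(dotBl ipd) /W; congr (ip _ _).
  by rewrite {1}fE (linear_onD linL)// opprD addrACA subrr addr0 addrK.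
have NW : `|W| ^+ 2 = `|gen p f| ^+ 2 + 2 * gamma * ip (gen p f) k
    + gamma ^+ 2 * `|k| ^+ 2.
  rewrite (sqr_normD ipd) (dotZr ipd) normrZ gtr0_norm// exprMn.
  by rewrite mulrA.
have Wg := le_trans (ler_norm _) (cauchy_schwarz ipd W (gen p g)).
have Lg : m2 * `|gen p g| ^+ 2 <= `|u| ^+ 2.
  apply: mul_le_sqr_of_mul_le (macro_dom Dg Hg) => //.
  rewrite -(dotff ipd); have := gE g Dg Hg; rewrite /E2 => ->.
  exact: le_trans (ler_norm _) (cauchy_schwarz ipd _ _).
have hk := coercive D0f; rewrite -/u -/k in hk.
have Lu : - ip (gen p f) u <= `|gen p f| * `|u|.
  by apply: le_trans (ler_norm _) _; rewrite normrN; exact: cauchy_schwarz.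
have ipE : ip f (gen p f) = ip (gen p f) u + ip (gen p f) k.
  by rewrite (dotC ipd) {2}fE (dotDr ipd).
have uf : `|u| <= `|f|.
  by rewrite -ler_sqr ?nnegrE// Nf lerDl sqr_ge0.
have U2 : `|u| ^+ 2 <= 2 / m2 * `|W| ^+ 2 + 2 * C2 ^+ 2 * `|k| ^+ 2.
  apply: sqr_le_of_young Lg => //; rewrite Nu.
  by apply: lerD Wg _; exact: hA.
have M1 : 2 / m2 <= M by rewrite le_max lexx.
have M2 : 1 + 2 * C2 ^+ 2 <= M * gamma ^+ 2.
  by rewrite -ler_pdivrMr ?exprn_gt0// le_max lexx orbT.
have M0 : 0 <= M by apply: le_trans M1; rewrite divr_ge0// ltW.
apply: (hypocoercive_arith _ _ M1 M2 Nf U2 NW _ Lu) => //; first exact: ltW.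
by rewrite -ipE.
Qed.

(** * From the core estimate to the three bounds *)

Let N := Num.max (2 * gamma / m2) ((1 + 2 * C2 ^+ 2) / gamma).

Let ME : gamma * M = N.
Proof.
rewrite /M /N maxr_pMr ?(ltW gamma0)//; congr Num.max.
  by rewrite mulrCA mulrA.
by field; rewrite gt_eqF.
Qed.

Let M_gt0 : 0 < M.
Proof. by rewrite lt_max divr_gt0. Qed.

(** M >= 1 / gamma^2, that is gamma sqrt M >= 1. Hence sqrt M + 2 gamma M <= 3 N, the constant of
    [gen_norm_bound_max]. *)
Let sqrtM_le : Num.sqrt M <= gamma * M.
Proof.
have sM : 0 < Num.sqrt M by rewrite sqrtr_gt0.
have -> : gamma * M = gamma * Num.sqrt M * Num.sqrt M.
  by rewrite -mulrA -expr2 sqr_sqrtr// ltW.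
rewrite ler_peMl ?(ltW sM)// -ler_sqr ?nnegrE ?mulr_ge0 ?(ltW sM) ?(ltW gamma0)//.
rewrite exprMn sqr_sqrtr ?(ltW M_gt0)// expr1n.
rewrite mulrC -ler_pdivrMr ?exprn_gt0// le_max; apply/orP; right.
by rewrite ler_pM2r ?invr_gt0 ?exprn_gt0// lerDl mulr_ge0 ?sqr_ge0.
Qed.

Lemma gen_norm_bound f : gen_dom p f -> L20 mu f ->
  `|f| <= (Num.sqrt M + 2 * gamma * M) * `|gen p f|.
Proof.
move=> Df f0; apply: (core_norm_le _ coreD0) => [|g D0g|//].
  by rewrite addr_ge0 ?sqrtr_ge0// mulr_ge0 ?(ltW M_gt0)// mulr_ge0 ?(ltW gamma0).
have h := D0_sqr_bound D0g.
rewrite mulrDl; apply: le_add_of_sqr_le.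
- by rewrite mulr_ge0 ?sqrtr_ge0.
- by rewrite !mulr_ge0 ?(ltW gamma0) ?(ltW M_gt0).
- rewrite exprMn sqr_sqrtr ?(ltW M_gt0)//; apply: le_trans h _.
  by rewrite le_eqVlt; apply/orP; left; apply/eqP; ring.
Qed.

Lemma gen_norm_bound_max f : gen_dom p f -> L20 mu f ->
  `|f| <= 3 * N * `|gen p f|.
Proof.
move=> Df f0; apply: le_trans (gen_norm_bound Df f0) _.
by rewrite ler_wpM2r// -ME; have := sqrtM_le; lra.
Qed.

Lemma time_avg_bound f t : L20 mu f -> 0 < t ->
  `|time_avg p t f| <= Num.sqrt M * `|gen p (time_avg p t f)|
    + 4 * gamma / t * M * `|f - Psg p t f|.
Proof.
move=> f0 t0; have [Dt Lt gt] := time_avg_dom t0 f0.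
apply: le_trans (gen_norm_bound Dt Lt) _.
(* The last term of the claim thus becomes 4 gamma M |L (time_avg t f)|, to be compared with the 2
   gamma M of [gen_norm_bound]. *)
have -> : `|f - Psg p t f| = t * `|gen p (time_avg p t f)|.
  by rewrite gt normrZ ger0_norm ?invr_ge0 ?(ltW t0)// mulVKf ?gt_eqF// distrC.
rewrite (_ : 4 * gamma / t * M * _ = 4 * gamma * M * `|gen p (time_avg p t f)|);
  last by field; rewrite gt_eqF.
rewrite mulrDl lerD2l ler_wpM2r// !ler_wpM2r ?(ltW M_gt0) ?(ltW gamma0)//.
by rewrite ler_nat.
Qed.

Let N_gt0 : 0 < N. Proof. by rewrite -ME mulr_gt0. Qed.

Lemma trel_avg_bound : (trel_avg mu p <= (16 * expR 1 * N)%:E)%E.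
Proof.
have e0 : 0 < expR 1 :> R by exact: expR_gt0.
apply: ereal_inf_lbound; exists (16 * expR 1 * N) => //; split.
  by rewrite !mulr_ge0 ?(ltW e0) ?(ltW N_gt0).
move=> s hs; apply: ge_ereal_sup => _ [f [f0 f1] <-]; rewrite lee_fin.
have s0 : 0 < s by apply: lt_le_trans hs; rewrite !mulr_gt0.
have [Dt Lt gt] := time_avg_dom s0 f0.
(* For |f| <= 1 the bound reads 3 N |P_s f - f| / s <= 6 N / s, which is at most 1 / e once s >= 16
   e N. *)
apply: le_trans (gen_norm_bound_max Dt Lt) _.
rewrite gt normrZ ger0_norm ?invr_ge0 ?(ltW s0)//.
have Pf2 : `|Psg p s f - f| <= 2.
  apply: le_trans (ler_normB _ _) _.
  by have := le_trans (sg_contract sgP f (ltW s0)) f1; move: f1 => /=; lra.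
rewrite mulrCA ler_pdivrMl// expRN.
apply: (@le_trans _ _ (16 * expR 1 * N * (expR 1)^-1)); last first.
  by rewrite ler_wpM2r// invr_ge0 ltW.
rewrite (_ : 16 * _ * _ / _ = 16 * N); last by field; rewrite gt_eqF.
have := ler_wpM2l (ltW N_gt0) Pf2; have := N_gt0; lra.
Qed.

Lemma sv_gap_bound :
  (((1 - expR (-1)) / (8 * expR 1) *
     Num.min (m2 / (2 * gamma)) (gamma / (1 + 2 * C2 ^+ 2)))%:E <= sv_gap mu p)%E.
Proof.
have e1 : 1 <= expR 1 :> R by apply: le_trans (expR_ge1Dx 1); rewrite lerDl.
have e0 : 0 < expR (-1) :> R by exact: expR_gt0.
have c0 : 0 < 1 + 2 * C2 ^+ 2 by rewrite addr_gt0// mulr_gt0// exprn_gt0.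
have mN : Num.min (m2 / (2 * gamma)) (gamma / (1 + 2 * C2 ^+ 2)) <= N^-1.
  have [h|h] := leP (2 * gamma / m2) ((1 + 2 * C2 ^+ 2) / gamma).
    by rewrite /N max_r// invf_div ge_min lexx orbT.
  by rewrite /N max_l ?(ltW h)// invf_div ge_min lexx.
have m0 : 0 <= Num.min (m2 / (2 * gamma)) (gamma / (1 + 2 * C2 ^+ 2)).
  by rewrite le_min !divr_ge0 ?mulr_ge0 ?(ltW gamma0) ?(ltW m20) ?(ltW c0).
apply: le_ereal_inf_tmp => _ [f [[Df f0] fn0] <-]; rewrite lee_fin.
have nf : 0 < `|f| by rewrite normr_gt0.
rewrite ler_pdivlMr//.
(* [gen_norm_bound_max] gives the gap 1 / (3 N); the stated constant is below 1 / (8 e), and e >= 1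
   puts this below 1 / 3. *)
have h1 : (1 - expR (-1)) / (8 * expR 1) <= 3^-1 :> R.
  rewrite ler_pdivrMr; last by lra.
  lra.
have N0 := N_gt0.
apply: (@le_trans _ _ (3^-1 * N^-1 * `|f|)).
  by rewrite ler_wpM2r// ler_pM// divr_ge0.
rewrite -invfM ler_pdivrMl ?mulr_gt0//.
exact: gen_norm_bound_max.
Qed.

End second_order_collapse.

Unset Implicit Arguments.
Set Strict Implicit.
Set Printing Implicit Defensive.

Theorem theorem18 (R : realType) (S : ptopologicalType)
    (p : R -> R.-pker (borel S) ~> (borel S))
    (mu : probability (borel S) R)
    (Hl Hh D0 : set (L2 mu)) (Pi : L2 mu -> L2 mu) (gamma m2 C2 : R) :
  polish_space R S ->
  transition_function p -> invariant_measure mu p -> strongly_continuous mu p ->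
  linear_subspace Hl -> closed Hl -> Hl `<=` L20 mu ->
  linear_subspace Hh -> closed Hh -> Hh `<=` L20 mu ->
  (forall u k, Hl u -> Hh k -> ip u k = 0) ->
  (forall f, L20 mu f -> exists u k, [/\ Hl u, Hh k & f = u + k]) ->
  orthogonal_projection Hl Pi ->
  core (gen p) (gen_dom p `&` L20 mu) D0 ->
  Pi @` D0 `<=` D0 ->
  core (gen p) (gen_dom p `&` Hl) (D0 `&` Hl) ->
  0 < gamma -> 0 < m2 -> 0 < C2 ->
  (forall f, D0 f -> - ip f (gen p f) >= gamma * `|f - Pi f| ^+ 2) ->
  (forall f, (D0 `&` Hl) f -> `|gen p f| ^+ 2 >= m2 * `|f| ^+ 2) ->
  (forall f g, (D0 `&` Hh) f -> collapse2_dom p Hl g ->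
     ip (opA p gamma Pi f) (opA p gamma Pi g) <=
     C2 * `|f| * `|collapse2 p Hl g|) ->
  let M := Num.max (2 / m2) ((1 + 2 * C2 ^+ 2) / gamma ^+ 2) in
  [/\ (forall f t, L20 mu f -> 0 < t ->
         `|time_avg p t f| <=
           Num.sqrt M * `|gen p (time_avg p t f)|
           + 4 * gamma / t * M * `|f - Psg p t f|),
      (trel_avg mu p <=
         (16 * expR 1 * Num.max (2 * gamma / m2)
            ((1 + 2 * C2 ^+ 2) / gamma))%:E)%E &
      (((1 - expR (-1)) / (8 * expR 1) *
          Num.min (m2 / (2 * gamma)) (gamma / (1 + 2 * C2 ^+ 2)))%:E
         <= sv_gap mu p)%E].
Proof.
move=> _ tp inv sc sHl cHl Hl0 sHh _ Hh0 HlHh decomp PiP coreD0 PiD0 coreD0l.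
move=> gamma0 m20 C20 coercive macro bounded M; split.
- by move=> f t f0 t0; apply: (time_avg_bound (Hl := Hl) (Hh := Hh) (D0 := D0)
    (Pi := Pi)).
- by apply: (trel_avg_bound (Hl := Hl) (Hh := Hh) (D0 := D0) (Pi := Pi)).
- by apply: (sv_gap_bound (Hl := Hl) (Hh := Hh) (D0 := D0) (Pi := Pi)).
Qed.
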